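(* For every $n\ge1$ there is an isomorphism of graded abelian groups $$\mathrm{Ext}^*(\mathrm{ab},\mathrm{Pa}_n)\cong\begin{cases}\Sigma^{n-1}\mathbb Z& n\text{ odd}\\ 0& n\text{ even,}\end{cases}$$ where $\Sigma^{n-1}\mathbb Z$ denotes the graded group that is $\mathbb Z$ in degree $*=n-1$ and zero in all other degrees.
   Context: $\mathrm{Ext}$ is taken in the abelian category of functors from finitely generated free groups to abelian groups. $\mathrm{ab}$ is the abelianization functor. $\mathrm{Pa}_n$ is the $n$-th Passi functor $\mathrm{Pa}_n(G)=I(G)/I(G)^{n+1}$, where $I(G)=\ker(\mathbb Z[G]\to\mathbb Z)$ is the augmentation ideal. *)

(* Defs.v *)
From HB Require Import structures.
From mathcomp Require Import all_boot all_algebra.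
From mathcomp Require Import finmap monalg boolp.

Set Implicit Arguments.
Unset Strict Implicit.
Unset Printing Implicit Defensive.

Import GRing.Theory.
Local Open Scope ring_scope.

Lemma additive_ext (U V : zmodType) (f g : {additive U -> V}) :
  f =1 g -> f = g.
Proof.
case: f g => f [[fD]] [g [[gD]]] /= /funext fg.
by subst g; rewrite (Prop_irrelevance fD gD).
Qed.

Lemma multiplicative_ext (G H : groupType) (f g : {multiplicative G -> H}) :
  f =1 g -> f = g.
Proof.
case: f g => f [[fM]] [g [[gM]]] /= /funext fg.
by subst g; rewrite (Prop_irrelevance fM gM).
Qed.

Section Subgroups.
Variable V : zmodType.

Inductive zgenerated (X : V -> Prop) : V -> Prop :=
| generated_in x : X x -> zgenerated X x
| generated0 : zgenerated X 0
| generatedB x y : zgenerated X x -> zgenerated X y -> zgenerated X (x - y).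

Definition zspan (X : V -> Prop) : {pred V} := fun x => `[< zgenerated X x >].

Lemma span_zmod_closed X : zmod_closed (zspan X).
Proof.
split=> [|x y /asboolP Xx /asboolP Xy]; apply/asboolP; first exact: generated0.
exact: generatedB.
Qed.
HB.instance Definition _ X :=
  GRing.isZmodClosed.Build V (zspan X) (span_zmod_closed X).

End Subgroups.

Section KernelImage.
Variables (U V : zmodType) (f : {additive U -> V}).

Definition ker_pred : {pred U} := fun x => f x == 0.

Lemma kernel_zmod_closed : zmod_closed ker_pred.
Proof.
split=> [|x y]; rewrite !unfold_in ?raddf0 // => /eqP fx /eqP fy.
by rewrite raddfB fx fy subrr.
Qed.
HB.instance Definition _ := GRing.isZmodClosed.Build U ker_pred
  kernel_zmod_closed.

Definition im_pred : {pred V} := fun y => `[< exists x, f x = y >].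

Lemma image_zmod_closed : zmod_closed im_pred.
Proof.
split=> [|_ _ /asboolP[x <-] /asboolP[y <-]]; apply/asboolP.
  by exists 0; rewrite raddf0.
by exists (x - y); rewrite raddfB.
Qed.
HB.instance Definition _ := GRing.isZmodClosed.Build V im_pred
  image_zmod_closed.

End KernelImage.

Section TrivialSubgroups.
Variable V : zmodType.

Definition zero_subgroup : {pred V} := fun x => x == 0.

Lemma zero_zmod_closed : zmod_closed zero_subgroup.
Proof.
by split=> [|x y]; rewrite !unfold_in // => /eqP-> /eqP->; rewrite subrr.
Qed.
HB.instance Definition _ :=
  GRing.isZmodClosed.Build V zero_subgroup zero_zmod_closed.

Definition full_subgroup : {pred V} := predT.

Lemma full_zmod_closed : zmod_closed full_subgroup.
Proof. by []. Qed.
HB.instance Definition _ :=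
  GRing.isZmodClosed.Build V full_subgroup full_zmod_closed.

End TrivialSubgroups.

Section Subquotient.
Variable V : zmodType.

Definition subgroup (Z : zmodClosed V) := {x : V | x \in Z}.
HB.instance Definition _ Z := SubChoice.on (subgroup Z).
HB.instance Definition _ Z := [SubChoice_isSubZmodule of subgroup Z by <:].

Variables Z B : zmodClosed V.

Definition restriction : {pred subgroup Z} := fun x => val x \in B.

Lemma restrictionE x : (x \in restriction) = (val x \in B).
Proof. by []. Qed.

Lemma restriction_zmod_closed : zmod_closed restriction.
Proof.
split=> [|x y]; rewrite !restrictionE; first by rewrite raddf0 rpred0.
by move=> Bx By; rewrite raddfB rpredB.
Qed.
HB.instance Definition _ :=
  GRing.isZmodClosed.Build (subgroup Z) restriction restriction_zmod_closed.

(* The quotient of Z by its intersection with B; it is Z / B when B is        *)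
(* contained in Z.                                                            *)
Definition subquotient : zmodType := Quotient.quot restriction.

Definition subquotient_class (x : subgroup Z) : subquotient :=
  \pi_(Quotient.quot restriction)%qT x.

End Subquotient.


Section SubquotientTheory.
Variables (V : zmodType) (Z B : zmodClosed V).

Lemma subquotient_classB : {morph @subquotient_class V Z B : x y / x - y}.
Proof. by move=> x y; rewrite /subquotient_class raddfB. Qed.

Lemma subquotient_class_surj (q : subquotient Z B) :
  exists x, subquotient_class B x = q.
Proof. by exists (repr q); exact: reprK. Qed.

Lemma subquotient_classP (x y : subgroup Z) :
  (subquotient_class B x = subquotient_class B y) <-> val x - val y \in B.
Proof.
rewrite -raddfB -restrictionE Quotient.idealrBE.
by split=> [/eqP|/eqP].
Qed.

End SubquotientTheory.

Section SubquotientMap.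
Variables (V W : zmodType) (ZV BV : zmodClosed V) (ZW BW : zmodClosed W).
Variable f : {additive V -> W}.
Hypothesis fZ : {homo f : x / x \in ZV >-> x \in ZW}.
Hypothesis fB : {homo f : x / x \in BV >-> x \in BW}.

Definition subgroup_map (x : subgroup ZV) : subgroup ZW :=
  exist _ (f (val x)) (fZ (valP x)).

Definition subquotient_map (q : subquotient ZV BV) : subquotient ZW BW :=
  subquotient_class BW (subgroup_map (repr q)).

Lemma subquotient_mapE x :
  subquotient_map (subquotient_class BV x) =
  subquotient_class BW (subgroup_map x).
Proof.
apply/subquotient_classP; rewrite /= -raddfB; apply: fB.
by apply/(subquotient_classP BV); exact: reprK.
Qed.

Lemma subquotient_map_is_zmod_morphism : zmod_morphism subquotient_map.
Proof.
move=> p q; have [x <-] := subquotient_class_surj p.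
have [y <-] := subquotient_class_surj q.
rewrite -subquotient_classB !subquotient_mapE -subquotient_classB.
by congr subquotient_class; apply: val_inj; rewrite /= !raddfB.
Qed.

End SubquotientMap.

Arguments subquotient_map {V W ZV BV ZW BW f} fZ q.
Arguments subquotient_mapE {V W ZV BV ZW BW f} fZ fB x.
Arguments subquotient_map_is_zmod_morphism {V W ZV BV ZW BW f} fZ fB.

Section Lift.
Variables (K : choiceType) (V : zmodType) (f : K -> V).

(* The extension of f to a morphism on the free abelian group on K.           *)
Definition malg_lift (x : {malg int[K]}) : V := \sum_(k <- msupp x) f k *~ x@_k.

Lemma liftEw (x : {malg int[K]}) (D : {fset K}) :
  (msupp x `<=` D)%fset -> malg_lift x = \sum_(k <- D) f k *~ x@_k.
Proof.
move=> xD; rewrite /malg_lift (big_fset_incl _ xD) // => k _ /mcoeff_outdom ->.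
by rewrite mulr0z.
Qed.

Lemma lift_is_zmod_morphism : zmod_morphism malg_lift.
Proof.
move=> x y; pose D := (msupp x `|` msupp y)%fset.
rewrite (@liftEw x D) ?fsubsetUl // (@liftEw y D) ?fsubsetUr //.
rewrite (@liftEw _ D) ?msuppB_le // -sumrB; apply: eq_bigr => k _.
by rewrite mcoeffB mulrzBr.
Qed.
HB.instance Definition _ :=
  GRing.isZmodMorphism.Build _ _ malg_lift lift_is_zmod_morphism.

Lemma liftU k : malg_lift << k >> = f k.
Proof.
by rewrite (@liftEw _ [fset k]%fset) ?msuppU_le // big_seq_fset1 mcoeffUU.
Qed.

End Lift.

Lemma malg_ext (K : choiceType) (V : zmodType)
    (f g : {additive {malg int[K]} -> V}) :
  (forall k, f << k >> = g << k >>) -> f =1 g.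
Proof.
move=> fg x; rewrite [x]monalgE !raddf_sum; apply: eq_bigr => k _ /=.
have -> : << x@_k *g k >> = << k >> *~ x@_k :> {malg int[K]}.
  by rewrite -(raddfMz (mkmalgU k)) intz.
by rewrite !raddfMz fg.
Qed.

Section GroupRing.
Variable G : groupType.

Definition group_ring := {malg int[G]}.
HB.instance Definition _ := GRing.Zmodule.on group_ring.

Implicit Types x y z : group_ring.

Definition gr_of (g : G) : group_ring := << g >>.

Definition gr_one : group_ring := gr_of 1%g.
Definition gr_mul x y : group_ring :=
  malg_lift (fun g => malg_lift (fun h => gr_of (g * h)%g) y) x.

Lemma gr_mul_of g h : gr_mul (gr_of g) (gr_of h) = gr_of (g * h)%g.
Proof. by rewrite /gr_mul /gr_of !liftU. Qed.

Lemma gr_mulBl x y z : gr_mul (x - y) z = gr_mul x z - gr_mul y z.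
Proof. exact: lift_is_zmod_morphism. Qed.

Lemma gr_mulBr x y z : gr_mul x (y - z) = gr_mul x y - gr_mul x z.
Proof.
rewrite /gr_mul /malg_lift -sumrB; apply: eq_bigr => g _.
by rewrite -mulrzBl; congr (_ *~ _); exact: lift_is_zmod_morphism.
Qed.

Definition gr_mull z x := gr_mul x z.
HB.instance Definition _ z :=
  GRing.isZmodMorphism.Build group_ring group_ring (gr_mull z)
    (fun x y => gr_mulBl x y z).
HB.instance Definition _ z :=
  GRing.isZmodMorphism.Build group_ring group_ring (gr_mul z) (gr_mulBr z).

Lemma gr_mulA : associative gr_mul.
Proof.
move=> x y z.
apply: (malg_ext (f := gr_mull (gr_mul y z)) (g := gr_mull z \o gr_mull y)).
move=> {x} g; rewrite /= /gr_mull.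
apply: (malg_ext (f := gr_mul (gr_of g) \o gr_mull z)
                 (g := gr_mull z \o gr_mul (gr_of g))).
move=> {y} h; rewrite /= /gr_mull.
apply: (malg_ext (f := gr_mul (gr_of g) \o gr_mul (gr_of h))
                 (g := gr_mul (gr_mul (gr_of g) (gr_of h)))).
by move=> {z} k; rewrite /= !gr_mul_of mulgA.
Qed.

Lemma gr_mul1l : left_id gr_one gr_mul.
Proof.
move=> x; apply: (malg_ext (f := gr_mul gr_one) (g := idfun)) => g /=.
by rewrite gr_mul_of mul1g.
Qed.

Lemma gr_mul1r : right_id gr_one gr_mul.
Proof.
move=> x; apply: (malg_ext (f := gr_mull gr_one) (g := idfun)) => g /=.
by rewrite /gr_mull gr_mul_of mulg1.
Qed.

Lemma gr_mulDl : left_distributive gr_mul +%R.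
Proof. by move=> x y z; exact: (raddfD (gr_mull z)). Qed.

Lemma gr_mulDr : right_distributive gr_mul +%R.
Proof. by move=> x y z; exact: (raddfD (gr_mul x)). Qed.

Lemma gr_one_neq0 : gr_one != 0.
Proof. by rewrite monalgU_eq0. Qed.

HB.instance Definition _ := GRing.Zmodule_isNzRing.Build group_ring
  gr_mulA gr_mul1l gr_mul1r gr_mulDl gr_mulDr gr_one_neq0.

Definition augmentation : group_ring -> int := malg_lift (fun=> 1).
HB.instance Definition _ := GRing.Additive.on augmentation.

Definition augmentation_ideal : zmodClosed group_ring := ker_pred augmentation.

Definition ideal_mul (I J : {pred group_ring}) : zmodClosed group_ring :=
  zspan (fun z => exists x y, [/\ x \in I, y \in J & z = x * y]).

(* The powers I^n of an ideal I, with I^0 the whole ring.                     *)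
Fixpoint ideal_power (I : {pred group_ring}) (n : nat) :
    zmodClosed group_ring :=
  if n is m.+1 then ideal_mul I (ideal_power I m)
  else @full_subgroup group_ring.

End GroupRing.

Arguments gr_of {G} g.
Arguments augmentation {G} x.

Section GroupRingMap.
Variables (G H : groupType) (f : {multiplicative G -> H}).

Definition group_ring_map : group_ring G -> group_ring H :=
  malg_lift (fun g => gr_of (f g)).
HB.instance Definition _ := GRing.Additive.on group_ring_map.

Lemma group_ring_map_of g : group_ring_map (gr_of g) = gr_of (f g).
Proof. exact: liftU. Qed.

Lemma group_ring_mapM : {morph group_ring_map : x y / x * y}.
Proof.
move=> x y.
apply: (malg_ext (f := group_ring_map \o gr_mull y)
                 (g := gr_mull (group_ring_map y) \o group_ring_map)).
move=> {x} g; rewrite /= /gr_mull.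
apply: (malg_ext (f := group_ring_map \o gr_mul (gr_of g))
                 (g := gr_mul (group_ring_map (gr_of g)) \o group_ring_map)).
move=> {y} h /=.
by rewrite gr_mul_of !group_ring_map_of gr_mul_of gmulfM.
Qed.

Lemma augmentation_map x : augmentation (group_ring_map x) = augmentation x.
Proof.
apply: (malg_ext (f := augmentation \o group_ring_map) (g := augmentation)).
by move=> g /=; rewrite group_ring_map_of /augmentation !liftU.
Qed.

Lemma group_ring_map_ideal :
  {homo group_ring_map : x / x \in augmentation_ideal G
                         >-> x \in augmentation_ideal H}.
Proof. by move=> x; rewrite !unfold_in /= augmentation_map. Qed.

Lemma group_ring_map_power n :
  {homo group_ring_map : x / x \in ideal_power (augmentation_ideal G) n
                         >-> x \in ideal_power (augmentation_ideal H) n}.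
Proof.
elim: n => [|n IHn] //= x /asboolP Ix; apply/asboolP.
elim: Ix => [_ [y] [z] [Iy Iz ->]||y z _ Iy _ Iz].
- apply: generated_in; exists (group_ring_map y), (group_ring_map z).
  by split; [exact: group_ring_map_ideal|exact: IHn|exact: group_ring_mapM].
- by rewrite raddf0; exact: generated0.
- by rewrite raddfB; exact: generatedB.
Qed.

End GroupRingMap.

Section Abelianization.
Variable G : groupType.
Local Open Scope group_scope.

(* The commutator subgroup [G, G].                                            *)
Inductive derived : G -> Prop :=
| derivedR x y : derived [~ x, y]
| derived1 : derived 1
| derivedM x y : derived x -> derived y -> derived (x * y)
| derivedV x : derived x -> derived x^-1.

Lemma derivedJ x y : derived x -> derived (x ^ y).
Proof.
move=> Dx; have -> : x ^ y = x * [~ x, y] by rewrite /commg mulgA mulgV mul1g.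
by apply: derivedM => //; exact: derivedR.
Qed.

Definition derived_equiv (x y : G) : bool := `[< derived (x / y) >].

Lemma derived_equiv_class : equiv_class_of derived_equiv.
Proof.
split=> [x|x y|y x z]; first by apply/asboolP; rewrite mulgV; exact: derived1.
  apply/asboolP/asboolP => /derivedV; by rewrite invgF.
move=> /asboolP xy /asboolP yz; apply/asboolP.
by have := derivedM xy yz; rewrite mulgA mulgVK.
Qed.
Canonical derived_equiv_equiv := EquivRelPack derived_equiv_class.
Canonical derived_equiv_encModRel := defaultEncModRel derived_equiv.

(* G / [G, G], written additively.                                            *)
Definition abelianization := {eq_quot derived_equiv}%qT.
HB.instance Definition _ := Choice.on abelianization.

Definition ab_class (x : G) : abelianization :=
  (\pi_abelianization x)%qT.

Lemma ab_classP x y : ab_class x = ab_class y <-> derived (x / y).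
Proof.
split=> [/eqP|Dxy]; last by apply/eqP; rewrite piE; apply/asboolP.
by rewrite piE => /asboolP.
Qed.

Lemma ab_class_surj (a : abelianization) : exists x, ab_class x = a.
Proof. by exists (repr a); exact: reprK. Qed.

Definition ab_add (a b : abelianization) := ab_class (repr a * repr b).
Definition ab_opp (a : abelianization) := ab_class (repr a)^-1.
Definition ab_zero := ab_class 1.

Lemma ab_class_repr x : derived (repr (ab_class x) / x).
Proof. by apply/ab_classP; exact: reprK. Qed.

Lemma ab_addE x y : ab_add (ab_class x) (ab_class y) = ab_class (x * y).
Proof.
apply/ab_classP; set x' := repr _; set y' := repr _.
have Dx : derived (x' / x) := ab_class_repr x.
have Dy : derived (y' / y) := ab_class_repr y.
have -> : x' * y' / (x * y) = (x' / x) * ((y' / y) ^ x^-1).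
  by rewrite /conjg invgK invgM !mulgA mulgVK.
by apply: derivedM => //; exact: derivedJ.
Qed.

Lemma ab_oppE x : ab_opp (ab_class x) = ab_class x^-1.
Proof.
apply/ab_classP; set x' := repr _.
have Dx : derived (x' / x) := ab_class_repr x.
have -> : x'^-1 / x^-1 = (x' / x)^-1 ^ x.
  by rewrite /conjg invgF invgK !mulgA mulVg mul1g.
by apply: derivedJ; exact: derivedV.
Qed.

Lemma ab_addA : associative ab_add.
Proof.
move=> a b c; have [x <-] := ab_class_surj a; have [y <-] := ab_class_surj b.
by have [z <-] := ab_class_surj c; rewrite !ab_addE mulgA.
Qed.

Lemma ab_addC : commutative ab_add.
Proof.
move=> a b; have [x <-] := ab_class_surj a; have [y <-] := ab_class_surj b.
rewrite !ab_addE; apply/ab_classP; rewrite invgM.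
have -> : x * y * (x^-1 * y^-1) = [~ x^-1, y^-1].
  by rewrite /commg /conjg !invgK !mulgA.
exact: derivedR.
Qed.

Lemma ab_add0 : left_id ab_zero ab_add.
Proof. by move=> a; have [x <-] := ab_class_surj a; rewrite ab_addE mul1g. Qed.

Lemma ab_addN : left_inverse ab_zero ab_opp ab_add.
Proof.
by move=> a; have [x <-] := ab_class_surj a; rewrite ab_oppE ab_addE mulVg.
Qed.

HB.instance Definition _ :=
  GRing.isZmodule.Build abelianization ab_addA ab_addC ab_add0 ab_addN.

Lemma ab_classM x y : ab_class (x * y) = (ab_class x + ab_class y)%R.
Proof. by rewrite -[RHS]/(ab_add _ _) ab_addE. Qed.

Lemma ab_classF x y : ab_class (x / y) = (ab_class x - ab_class y)%R.
Proof. by rewrite ab_classM -ab_oppE. Qed.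

End Abelianization.

Section AbelianizationMap.
Variables (G H : groupType) (f : {multiplicative G -> H}).
Local Open Scope group_scope.

Lemma mult_id1 : f 1 = 1.
Proof. by apply: (mulgI (f 1)); rewrite -gmulfM !mulg1. Qed.

Lemma mult_inv x : f x^-1 = (f x)^-1.
Proof. by apply: (mulgI (f x)); rewrite -gmulfM !mulgV mult_id1. Qed.

Lemma derived_map x : derived x -> derived (f x).
Proof.
elim=> {x} [x y||x y _ Dx _ Dy|x _ Dx].
- rewrite /commg /conjg !gmulfM !mult_inv; exact: derivedR.
- by rewrite mult_id1; exact: derived1.
- by rewrite gmulfM; exact: derivedM.
- by rewrite mult_inv; exact: derivedV.
Qed.

Definition abelianization_map (a : abelianization G) : abelianization H :=
  ab_class (f (repr a)).

Lemma abelianization_mapE x : abelianization_map (ab_class x) = ab_class (f x).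
Proof.
apply/ab_classP; rewrite -mult_inv -gmulfM; apply: derived_map.
exact: ab_class_repr.
Qed.

Lemma abelianization_map_is_zmod_morphism : zmod_morphism abelianization_map.
Proof.
move=> a b; have [x <-] := ab_class_surj a; have [y <-] := ab_class_surj b.
by rewrite -ab_classF !abelianization_mapE gmulfM mult_inv ab_classF.
Qed.
HB.instance Definition _ :=
  GRing.isZmodMorphism.Build _ _ abelianization_map
    abelianization_map_is_zmod_morphism.

End AbelianizationMap.

Definition free_basis (G : groupType) (n : nat) (b : 'I_n -> G) : Prop :=
  forall (H : groupType) (h : 'I_n -> H),
    exists! f : {multiplicative G -> H}, forall i, f (b i) = h i.

HB.mixin Record isFGFree G of Group G := {
  fg_freeP : exists (n : nat) (b : 'I_n -> G), free_basis b
}.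

(* The morphisms between these groups are the {multiplicative G -> H}, which  *)
(* are all group morphisms since G and H are groups.                          *)
#[short(type="fgFreeGroupType")]
HB.structure Definition FGFree := {G of isFGFree G & Group G}.

Record functor := Functor {
  fobj :> fgFreeGroupType -> zmodType;
  fmap : forall G H : fgFreeGroupType,
    {multiplicative G -> H} -> {additive fobj G -> fobj H};
  fmap_id : forall (G : fgFreeGroupType) x,
    fmap (idfun : {multiplicative G -> G}) x = x;
  fmap_comp : forall (G H K : fgFreeGroupType)
      (g : {multiplicative H -> K}) (f : {multiplicative G -> H}) x,
    fmap (g \o f : {multiplicative G -> K}) x = fmap g (fmap f x)
}.

Arguments fmap F {G H} f : rename.

Record nat_trans (F E : functor) := NatTrans {
  ncomp :> forall G : fgFreeGroupType, {additive F G -> E G};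
  ncompE : forall (G H : fgFreeGroupType) (f : {multiplicative G -> H}) x,
    ncomp H (fmap F f x) = fmap E f (ncomp G x)
}.

HB.instance Definition _ F E := gen_eqMixin (nat_trans F E).
HB.instance Definition _ F E := gen_choiceMixin (nat_trans F E).

Lemma nat_trans_ext F E (s t : nat_trans F E) :
  (forall G x, s G x = t G x) -> s = t.
Proof.
case: s t => s sE [t tE] /= st.
have {}st : s = t by apply: functional_extensionality_dep => G;
  exact: additive_ext (st G).
by subst t; rewrite (Prop_irrelevance sE tE).
Qed.

Section NatTransZmodule.
Variables F E : functor.
Implicit Types s t u : nat_trans F E.

Program Definition nzero : nat_trans F E :=
  @NatTrans F E (fun G => \0 : {additive F G -> E G}) _.
Next Obligation. by rewrite raddf0. Qed.

Program Definition nadd s t : nat_trans F E :=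
  @NatTrans F E (fun G => s G \+ t G : {additive F G -> E G}) _.
Next Obligation. by rewrite !ncompE raddfD. Qed.

Program Definition nopp s : nat_trans F E :=
  @NatTrans F E (fun G => \- (s G) : {additive F G -> E G}) _.
Next Obligation. by rewrite !ncompE raddfN. Qed.

Lemma naddA : associative nadd.
Proof. by move=> s t u; apply: nat_trans_ext => G x /=; rewrite addrA. Qed.

Lemma naddC : commutative nadd.
Proof. by move=> s t; apply: nat_trans_ext => G x /=; rewrite addrC. Qed.

Lemma nadd0 : left_id nzero nadd.
Proof. by move=> s; apply: nat_trans_ext => G x /=; rewrite add0r. Qed.

Lemma naddN : left_inverse nzero nopp nadd.
Proof. by move=> s; apply: nat_trans_ext => G x /=; rewrite addNr. Qed.

HB.instance Definition _ :=
  GRing.isZmodule.Build (nat_trans F E) naddA naddC nadd0 naddN.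

End NatTransZmodule.

Program Definition nat_comp F E D (t : nat_trans E D) (s : nat_trans F E) :
    nat_trans F D :=
  @NatTrans F D (fun G => t G \o s G : {additive F G -> D G}) _.
Next Obligation. by rewrite !ncompE. Qed.

(* Kernels and cokernels in the category of functors are computed pointwise,  *)
(* hence so are epimorphisms and exactness.                                   *)
Definition epi F E (p : nat_trans F E) : Prop :=
  forall G y, exists x, p G x = y.

Definition projective (P : functor) : Prop :=
  forall (F E : functor) (p : nat_trans F E) (f : nat_trans P E),
    epi p -> exists g : nat_trans P F, nat_comp p g = f.

Definition exact_at F E D (s : nat_trans F E) (t : nat_trans E D) : Prop :=
  forall G y, t G y = 0 <-> exists x, s G x = y.

Record resolution (A : functor) := Resolution {
  res :> nat -> functor;
  res_diff : forall i, nat_trans (res i.+1) (res i);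
  res_aug : nat_trans (res 0) A;
  res_projective : forall i, projective (res i);
  res_epi : epi res_aug;
  res_exact0 : exact_at (res_diff 0) res_aug;
  res_exact : forall i, exact_at (res_diff i.+1) (res_diff i)
}.

Section Cohomology.
Variables (A : functor) (P : resolution A) (B : functor).

Definition codiff i (f : nat_trans (P i) B) : nat_trans (P i.+1) B :=
  nat_comp f (res_diff P i).

Lemma codiff_is_zmod_morphism i : zmod_morphism (@codiff i).
Proof. by move=> s t; apply: nat_trans_ext. Qed.
HB.instance Definition _ i :=
  GRing.isZmodMorphism.Build _ _ (@codiff i) (@codiff_is_zmod_morphism i).

Definition cocycles i : zmodClosed (nat_trans (P i) B) := ker_pred (@codiff i).

Definition coboundaries i : zmodClosed (nat_trans (P i) B) :=
  match i with
  | 0 => @zero_subgroup (nat_trans (P 0) B)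
  | j.+1 => im_pred (@codiff j)
  end.

Definition cohomology i : zmodType :=
  subquotient (cocycles i) (coboundaries i).

End Cohomology.

(* The direct sum, over all X and all a in A X, of the representable functors *)
(* Z[Hom(X, -)], which are projective by the Yoneda lemma. The index set is   *)
(* the whole type of finitely generated free groups: this is allowed because  *)
(* fgFreeGroupType lives in a universe below that of the carriers of zmodType.*)
Section Cover.
Variable A : functor.

Record cover_basis (G : fgFreeGroupType) := CoverBasis {
  cb_dom : fgFreeGroupType;
  cb_elt : A cb_dom;
  cb_hom : {multiplicative cb_dom -> G}
}.
HB.instance Definition _ G := gen_eqMixin (cover_basis G).
HB.instance Definition _ G := gen_choiceMixin (cover_basis G).

Definition cb_map (G H : fgFreeGroupType) (f : {multiplicative G -> H})
    (k : cover_basis G) : cover_basis H :=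
  @CoverBasis H (cb_dom k) (cb_elt k)
    (f \o cb_hom k : {multiplicative _ -> _}).

Lemma cb_map_id (G : fgFreeGroupType) :
  @cb_map G G (idfun : {multiplicative G -> G}) =1 id.
Proof.
case=> X a h; rewrite /cb_map /=; congr CoverBasis.
exact: multiplicative_ext.
Qed.

Lemma cb_map_comp (G H K : fgFreeGroupType)
    (g : {multiplicative H -> K}) (f : {multiplicative G -> H}) k :
  cb_map (g \o f : {multiplicative G -> K}) k = cb_map g (cb_map f k).
Proof.
case: k => X a h; rewrite /cb_map /=; congr CoverBasis.
exact: multiplicative_ext.
Qed.

Definition cover_map (G H : fgFreeGroupType) (f : {multiplicative G -> H}) :
    {additive {malg int[cover_basis G]} -> {malg int[cover_basis H]}} :=
  malg_lift (fun k => << cb_map f k >>).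

Lemma cover_map_id (G : fgFreeGroupType) x :
  cover_map (idfun : {multiplicative G -> G}) x = x.
Proof.
apply: (malg_ext (f := cover_map _) (g := idfun)) => k /=.
by rewrite liftU cb_map_id.
Qed.

Lemma cover_map_comp (G H K : fgFreeGroupType)
    (g : {multiplicative H -> K}) (f : {multiplicative G -> H}) x :
  cover_map (g \o f : {multiplicative G -> K}) x = cover_map g (cover_map f x).
Proof.
apply: (malg_ext (f := cover_map _) (g := cover_map g \o cover_map f)) => k /=.
by rewrite !liftU cb_map_comp.
Qed.

Definition free_cover : functor :=
  @Functor (fun G => {malg int[cover_basis G]}) cover_map
    cover_map_id cover_map_comp.

Section CoverLift.
Variables (E : functor) (e : forall X : fgFreeGroupType, A X -> E X).

Lemma cover_lift_nat (G H : fgFreeGroupType) (f : {multiplicative G -> H}) x :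
  malg_lift (fun k : cover_basis H => fmap E (cb_hom k) (e (cb_elt k)))
    (fmap free_cover f x) =
  fmap E f
    (malg_lift (fun k : cover_basis G => fmap E (cb_hom k) (e (cb_elt k))) x).
Proof.
apply: (malg_ext (f := malg_lift _ \o cover_map f)
                 (g := fmap E f \o malg_lift _)) => k /=.
by rewrite !liftU fmap_comp.
Qed.

Definition cover_lift : nat_trans free_cover E :=
  @NatTrans free_cover E
    (fun G => malg_lift
      (fun k : cover_basis G => fmap E (cb_hom k) (e (cb_elt k))))
    cover_lift_nat.

End CoverLift.

Definition cover_gen (X : fgFreeGroupType) (a : A X) : free_cover X :=
  << CoverBasis a (idfun : {multiplicative X -> X}) >>.

Lemma cover_liftE E e X a :
  @cover_lift E e X (@cover_gen X a) = e X a.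
Proof. by rewrite /= liftU /= fmap_id. Qed.

Lemma cover_ext E (s t : nat_trans free_cover E) :
  (forall X a, s X (@cover_gen X a) = t X (@cover_gen X a)) -> s = t.
Proof.
move=> st; apply: nat_trans_ext => G.
apply: malg_ext => -[X a h].
have -> : << CoverBasis a h >> = fmap free_cover h (cover_gen a).
  rewrite /= liftU; congr mkmalgU; congr CoverBasis.
  exact: multiplicative_ext.
by rewrite !ncompE st.
Qed.

Lemma cover_projective : projective free_cover.
Proof.
move=> F E p f p_epi.
pose y X (a : A X) := cid (p_epi X (f X (cover_gen a))).
exists (cover_lift (fun X a => projT1 (y X a))); apply: cover_ext => X a.
rewrite -[LHS]/(p X (cover_lift _ X (cover_gen a))) cover_liftE.
exact: projT2 (y X a).
Qed.

Definition cover_aug : nat_trans free_cover A := cover_lift (fun X a => a).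

Lemma cover_aug_epi : epi cover_aug.
Proof. by move=> G a; exists (cover_gen a); rewrite cover_liftE. Qed.

End Cover.

Section KernelFunctor.
Variables (F E : functor) (s : nat_trans F E).

Definition nker_obj (G : fgFreeGroupType) : zmodType :=
  subgroup (ker_pred (s G)).

Section Map.
Variables (G H : fgFreeGroupType) (f : {multiplicative G -> H}).

Lemma nker_map_subproof (x : nker_obj G) : fmap F f (val x) \in ker_pred (s H).
Proof.
by case: x => x /= /eqP sx; apply/eqP; rewrite ncompE sx raddf0.
Qed.

Definition nker_map (x : nker_obj G) : nker_obj H :=
  exist _ (fmap F f (val x)) (nker_map_subproof x).

Lemma nker_map_is_zmod_morphism : zmod_morphism nker_map.
Proof. by move=> x y; apply: val_inj; rewrite /= !raddfB. Qed.
HB.instance Definition _ :=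
  GRing.isZmodMorphism.Build _ _ nker_map nker_map_is_zmod_morphism.

End Map.

Lemma nker_map_id (G : fgFreeGroupType) x :
  nker_map (idfun : {multiplicative G -> G}) x = x.
Proof. by apply: val_inj; rewrite /= fmap_id. Qed.

Lemma nker_map_comp (G H K : fgFreeGroupType)
    (g : {multiplicative H -> K}) (f : {multiplicative G -> H}) x :
  nker_map (g \o f : {multiplicative G -> K}) x = nker_map g (nker_map f x).
Proof. by apply: val_inj; rewrite /= fmap_comp. Qed.

Definition nker : functor :=
  @Functor nker_obj (fun G H f => nker_map f : {additive _ -> _})
    nker_map_id nker_map_comp.

Definition nker_incl : nat_trans nker F :=
  @NatTrans nker F
    (fun G => (val : subgroup (ker_pred (s G)) -> F G)
       : {additive nker G -> F G})
    (fun G H f x => erefl).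

End KernelFunctor.

(* A is covered by a free functor, the kernel of this cover is covered by     *)
(* another free functor, and so on.                                           *)
Fixpoint syzygy (A : functor) (i : nat) : functor :=
  if i is j.+1 then nker (cover_aug (syzygy A j)) else A.

Section StandardResolution.
Variable A : functor.

Definition std_res i : functor := free_cover (syzygy A i).

Definition std_diff i : nat_trans (std_res i.+1) (std_res i) :=
  nat_comp (nker_incl (cover_aug (syzygy A i))) (cover_aug (syzygy A i.+1)).

Lemma std_exact_image i G y :
  cover_aug (syzygy A i) G y = 0 <-> exists x, std_diff i G x = y.
Proof.
split=> [/eqP y0|[x <-]]; last exact/eqP/(valP (cover_aug (syzygy A i.+1) G x)).
have [x xy] := @cover_aug_epi (syzygy A i.+1) G (exist _ y y0).
by exists x; rewrite /= [malg_lift _ _]xy.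
Qed.

Lemma std_exact0 : exact_at (std_diff 0) (cover_aug A).
Proof. by move=> G y; exact: (@std_exact_image 0). Qed.

Lemma std_exact i : exact_at (std_diff i.+1) (std_diff i).
Proof.
move=> G y; rewrite -std_exact_image; split=> [y0|y0].
  by apply: val_inj; exact: y0.
by rewrite -[LHS]/(val (cover_aug (syzygy A i.+1) G y)) y0.
Qed.

Definition std_resolution : resolution A :=
  @Resolution A std_res std_diff (cover_aug A)
    (fun i => @cover_projective (syzygy A i)) (@cover_aug_epi A)
    std_exact0 std_exact.

End StandardResolution.

Definition graded_group : Type := nat -> zmodType.

(* The right derived functors of Hom(-, B) at A. Up to isomorphism the result *)
(* does not depend on the projective resolution; fixing one makes Ext a       *)
(* definite group and shows that resolutions exist.                           *)
Definition Ext (A B : functor) : graded_group :=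
  cohomology (std_resolution A) B.

Lemma ab_map_id (G : fgFreeGroupType) (a : abelianization G) :
  abelianization_map (idfun : {multiplicative G -> G}) a = a.
Proof. by have [x <-] := ab_class_surj a; rewrite abelianization_mapE. Qed.

Lemma ab_map_comp (G H K : fgFreeGroupType)
    (g : {multiplicative H -> K}) (f : {multiplicative G -> H}) a :
  abelianization_map (g \o f : {multiplicative G -> K}) a =
  abelianization_map g (abelianization_map f a).
Proof. by have [x <-] := ab_class_surj a; rewrite !abelianization_mapE. Qed.

Definition ab : functor :=
  @Functor abelianization
    (fun G H f => abelianization_map f : {additive _ -> _})
    ab_map_id ab_map_comp.

Section PassiFunctor.
Variable n : nat.

Definition passi_obj (G : groupType) : zmodType :=
  subquotient (augmentation_ideal G) (ideal_power (augmentation_ideal G) n.+1).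

Definition passi_map (G H : groupType) (f : {multiplicative G -> H}) :
    passi_obj G -> passi_obj H :=
  subquotient_map (@group_ring_map_ideal G H f).

Lemma passi_mapE (G H : groupType) (f : {multiplicative G -> H}) x :
  passi_map f (subquotient_class _ x) =
  subquotient_class _ (subgroup_map (@group_ring_map_ideal G H f) x).
Proof. exact: subquotient_mapE (@group_ring_map_power G H f n.+1) x. Qed.

HB.instance Definition _ (G H : groupType) (f : {multiplicative G -> H}) :=
  GRing.isZmodMorphism.Build (passi_obj G) (passi_obj H) (passi_map f)
    (subquotient_map_is_zmod_morphism _
       (@group_ring_map_power G H f n.+1)).

Lemma passi_map_id (G : fgFreeGroupType) q :
  passi_map (idfun : {multiplicative G -> G}) q = q.
Proof.
have [x <-] := subquotient_class_surj q; rewrite passi_mapE.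
congr subquotient_class; apply: val_inj; case: x => x _ /=.
apply: (malg_ext (f := group_ring_map _) (g := idfun)) => g.
exact: group_ring_map_of.
Qed.

Lemma passi_map_comp (G H K : fgFreeGroupType)
    (g : {multiplicative H -> K}) (f : {multiplicative G -> H}) q :
  passi_map (g \o f : {multiplicative G -> K}) q =
  passi_map g (passi_map f q).
Proof.
have [x <-] := subquotient_class_surj q; rewrite !passi_mapE.
congr subquotient_class; apply: val_inj => /=.
apply: (malg_ext (f := group_ring_map _)
                 (g := group_ring_map g \o group_ring_map f)) => k /=.
by rewrite !group_ring_map_of.
Qed.

Definition Pa : functor :=
  @Functor passi_obj
    (fun G H f => passi_map f : {additive _ -> _}) passi_map_id passi_map_comp.

End PassiFunctor.

Definition group_iso (U V : zmodType) : Prop :=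
  exists f : {additive U -> V}, bijective f.

Definition graded_iso (M N : graded_group) : Prop :=
  forall i, group_iso (M i) (N i).

Definition trivial_group : zmodType := 'rV[int]_0.

Definition graded_zero : graded_group := fun=> trivial_group.

(* V in degree k; this is the k-fold suspension of V placed in degree 0.      *)
Definition suspension (k : nat) (V : zmodType) : graded_group :=
  fun i => if i == k then V else trivial_group.

(* Main.v *)
Require Import Defs.
From HB Require Import structures.
From mathcomp Require Import all_boot all_algebra.
From mathcomp Require Import finmap monalg boolp.
From mathcomp Require Import zify.

Set Implicit Arguments.
Unset Strict Implicit.
Unset Printing Implicit Defensive.

Import GRing.Theory.
Local Open Scope ring_scope.

(** Write [F_k] for the free group on [k] letters and [I] for its augmentation
ideal.

The bar complex of a group [G], without its term of degree 0 and shifted by one,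
is functorial in [G]: in degree [i] it is the free abelian group on the
[i + 1]-tuples in [G]. Its homology in degree 0 is the abelianization, and it
vanishes in positive degrees if [G] is free. The term of degree [i] is
represented by [F_(i+1)], hence projective. So the bar complex is a projective
resolution of [ab] ([bar_resolution]), and by the Yoneda lemma and the
comparison of resolutions, Ext(ab, B) is the cohomology of the complex
B(F_1) -> B(F_2) -> ..., whose differential is the alternating sum of the maps
induced by the cofaces F_k -> F_(k+1): the coface [i] sends the letter [i] to
the product of the letters [i] and [i + 1], and renumbers the other letters
([yoneda_cobar], [bar_cohomology_trivial], [bar_cohomology_int]).

For the Passi functor this complex is I / I^(n+1) and carries the filtration by
the powers of [I]. By the Magnus expansion, that is by iterated Fox derivatives,
I^m / I^(m+1) is the group of functions on the words of length [m] in [k]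
letters. There the coface [i] acts by a monotone map on the letters
([coef_dR]), and the complex becomes that of reduced cochains on the [m]-fold
smash power of the simplicial circle. Its cohomology is therefore Z, in level
[k = m], generated by the product [x_1 ... x_m], where [1 + x_j] is the [j]-th
letter ([cocycle_words], [top_word_not_coboundary]). The proof replaces one
circle by an interval, which makes the complex contractible
([contract_homotopy]), and goes by induction on [m].

Finally the differential of [x_1 ... x_m] is [- x_1 ... x_(m+1)] if [m] is odd
and 0 if [m] is even ([dR_top]). So the contributions of [m] and [m + 1] cancel
for [m] odd ([odd_step]). Nothing is left if [n] is even; if [n] is odd, the
class of [x_1 ... x_n] survives, in level [k = n], that is in degree [n - 1].

Fox derivatives are used twice: the augmentation ideal of a free group is a free
module ([foxE]), which also gives the exactness of the bar complex
([barC_exact]). *)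

(** * Comparison of projective resolutions *)

Lemma nat_compA (F E D C : functor) (u : nat_trans D C) (t : nat_trans E D)
    (s : nat_trans F E) :
  nat_comp u (nat_comp t s) = nat_comp (nat_comp u t) s.
Proof. exact: nat_trans_ext. Qed.

Lemma nat_compBr (F E D : functor) (u : nat_trans E D) (s t : nat_trans F E) :
  nat_comp u (s - t) = nat_comp u s - nat_comp u t.
Proof. by apply: nat_trans_ext => G x /=; rewrite raddfB. Qed.

Lemma nat_compBl (F E D : functor) (s t : nat_trans E D) (u : nat_trans F E) :
  nat_comp (s - t) u = nat_comp s u - nat_comp t u.
Proof. exact: nat_trans_ext. Qed.

Lemma nat_comp0r (F E D : functor) (u : nat_trans E D) :
  nat_comp u (0 : nat_trans F E) = 0.
Proof. by apply: nat_trans_ext => G x /=; rewrite raddf0. Qed.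

Lemma nat_comp0l (F E D : functor) (u : nat_trans F E) :
  nat_comp (0 : nat_trans E D) u = 0.
Proof. exact: nat_trans_ext. Qed.

Lemma exact_comp0 (F E D : functor) (s : nat_trans F E) (t : nat_trans E D) :
  exact_at s t -> nat_comp t s = 0.
Proof. by move=> st; apply: nat_trans_ext => G x; apply/st; exists x. Qed.

Section Corestriction.
Variables (H E D : functor) (u : nat_trans H E) (t : nat_trans E D).
Hypothesis tu0 : nat_comp t u = 0.

Lemma corestr_subproof G (x : H G) : u G x \in ker_pred (t G).
Proof. by apply/eqP; have := congr1 (fun v : nat_trans H D => v G x) tu0. Qed.

Definition corestr_fun G (x : H G) : nker t G :=
  exist _ (u G x) (corestr_subproof x).

Lemma corestr_is_zmod_morphism G : zmod_morphism (@corestr_fun G).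
Proof. by move=> x y; apply: val_inj; rewrite /= raddfB. Qed.
HB.instance Definition _ G := GRing.isZmodMorphism.Build _ _ (@corestr_fun G)
  (@corestr_is_zmod_morphism G).

Lemma corestr_nat (G K : fgFreeGroupType) (h : {multiplicative G -> K}) x :
  corestr_fun (fmap H h x) = fmap (nker t) h (corestr_fun x).
Proof. by apply: val_inj; rewrite /= ncompE. Qed.

Definition corestr : nat_trans H (nker t) :=
  @NatTrans H (nker t) (fun G => @corestr_fun G : {additive H G -> nker t G})
    corestr_nat.

End Corestriction.

(** Corestricting [s] to the kernel of [t] gives an epimorphism, through which
    a map from a projective lifts. *)
Lemma projective_lift (P F E D : functor) (s : nat_trans F E)
    (t : nat_trans E D) (f : nat_trans P E) :
  projective P -> exact_at s t -> nat_comp t f = 0 ->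
  exists g : nat_trans P F, nat_comp s g = f.
Proof.
move=> projP st tf0; have ts0 := exact_comp0 st.
have epi_s : epi (corestr ts0).
  move=> G [y /= y0]; have /st[x sx] := eqP y0.
  by exists x; apply: val_inj.
have [g sg] := projP _ _ _ (corestr tf0) epi_s.
exists g; apply: nat_trans_ext => G x.
exact: (congr1 (fun u : nat_trans P (nker t) => val (u G x)) sg).
Qed.

Section Resolution.
Variables (A : functor) (P : resolution A).

(** The augmentation counts as the differential out of degree 0, so that the
    inductions below need no separate first step. *)
Definition prev (i : nat) : functor := if i is j.+1 then P j else A.

Definition diff (i : nat) : nat_trans (P i) (prev i) :=
  match i with 0 => res_aug P | j.+1 => res_diff P j end.

Lemma diff_exact i : exact_at (diff i.+1) (diff i).
Proof. by case: i => [|i]; [exact: res_exact0|exact: res_exact]. Qed.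

Lemma diff_comp0 i : nat_comp (diff i) (diff i.+1) = 0.
Proof. exact/exact_comp0/diff_exact. Qed.

End Resolution.

Section ChainMap.
Variables (A : functor) (P Q : resolution A).

Definition chain_map := forall i, nat_trans (P i) (Q i).

Definition is_chain_map (f : chain_map) : Prop :=
  nat_comp (diff Q 0) (f 0) = diff P 0 /\
  forall i, nat_comp (diff Q i.+1) (f i.+1) = nat_comp (f i) (diff P i.+1).

(** Only a component [f] with [d f d = 0] can be extended to the next degree;
    carrying this condition along allows the components to be chosen one by
    one. *)
Definition extensible i (f : nat_trans (P i) (Q i)) : Prop :=
  nat_comp (diff Q i) (nat_comp f (diff P i.+1)) = 0.

Lemma chain_map_step i (f : nat_trans (P i) (Q i)) : extensible f ->
  exists g : nat_trans (P i.+1) (Q i.+1),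
    nat_comp (diff Q i.+1) g = nat_comp f (diff P i.+1).
Proof.
move=> fE; exact: (projective_lift (@res_projective _ P i.+1)
                     (@diff_exact _ Q i) fE).
Qed.

Lemma chain_map_start : exists g : nat_trans (P 0) (Q 0),
  nat_comp (diff Q 0) g = diff P 0.
Proof. exact: (@res_projective _ P 0) (@res_epi _ Q). Qed.

Lemma extensible_start (f : nat_trans (P 0) (Q 0)) :
  nat_comp (diff Q 0) f = diff P 0 -> extensible f.
Proof. by rewrite /extensible nat_compA => ->; exact: diff_comp0. Qed.

Lemma extensible_step i (f : nat_trans (P i) (Q i))
    (g : nat_trans (P i.+1) (Q i.+1)) :
  nat_comp (diff Q i.+1) g = nat_comp f (diff P i.+1) -> extensible g.
Proof.
move=> fg; rewrite /extensible nat_compA fg -nat_compA diff_comp0.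
exact: nat_comp0r.
Qed.

Fixpoint chain_map_rec i : {f : nat_trans (P i) (Q i) | extensible f} :=
  match i with
  | 0 => let w := cid chain_map_start in
         exist _ (projT1 w) (extensible_start (projT2 w))
  | j.+1 => let w := cid (chain_map_step (proj2_sig (chain_map_rec j))) in
            exist _ (projT1 w) (extensible_step (projT2 w))
  end.

Lemma chain_map_exists : exists f, is_chain_map f.
Proof.
exists (fun i => proj1_sig (chain_map_rec i)); split=> [|i].
  exact: (projT2 (cid chain_map_start)).
exact: (projT2 (cid (chain_map_step (proj2_sig (chain_map_rec i))))).
Qed.

(** The part of a null homotopy that factors through the incoming
    differential; there is none in degree 0. *)
Definition factors_diff i : nat_trans (P i) (Q i) -> Prop :=
  match i with
  | 0 => fun u => u = 0
  | j.+1 => fun u => exists h : nat_trans (P j) (Q j.+1),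
                       u = nat_comp h (diff P j.+1)
  end.

Lemma factors_diff0 i (u : nat_trans (P i) (Q i)) :
  factors_diff u -> nat_comp u (diff P i.+1) = 0.
Proof.
case: i u => [|i] u /= => [->|[h ->]]; first exact: nat_comp0l.
by rewrite -nat_compA diff_comp0 nat_comp0r.
Qed.

(** The homotopy is lifted from one degree to the next: its defect in the next
    degree is killed by the differential. *)
Lemma chain_homotopy (f g : chain_map) : is_chain_map f -> is_chain_map g ->
  forall i, exists h : nat_trans (P i) (Q i.+1),
    factors_diff (f i - g i - nat_comp (diff Q i.+1) h).
Proof.
move=> [f0 fS] [g0 gS]; elim=> [|i [h /factors_diff0 fgh]].
  have [|h hE] := projective_lift (f := f 0%N - g 0%N) (@res_projective _ P 0)
    (@diff_exact _ Q 0); first by rewrite nat_compBr f0 g0 subrr.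
  by exists h; rewrite /factors_diff hE subrr.
have [|k kE] := projective_lift
    (f := f i.+1 - g i.+1 - nat_comp h (diff P i.+1))
    (@res_projective _ P i.+1) (@diff_exact _ Q i.+1).
  by rewrite !nat_compBr fS gS nat_compA -!nat_compBl.
exists k, h; rewrite kE.
by rewrite opprB addrCA subrr addr0.
Qed.

End ChainMap.

Section Comparison.
Variables (A B : functor).

Lemma cocycleP (P : resolution A) i (s : nat_trans (P i) B) :
  s \in cocycles P B i <-> nat_comp s (diff P i.+1) = 0.
Proof. by split=> /eqP. Qed.

Lemma coboundaryS (P : resolution A) i (s : nat_trans (P i.+1) B) :
  s \in coboundaries P B i.+1 <-> exists t, s = nat_comp t (diff P i.+1).
Proof.
split=> [/asboolP[t <-]|[t ->]]; first by exists t.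
by apply/asboolP; exists t.
Qed.

Variables (P Q : resolution A) (f : chain_map P Q) (fP : is_chain_map f).

Definition pullback i (s : nat_trans (Q i) B) : nat_trans (P i) B :=
  nat_comp s (f i).

Lemma pullback_is_zmod_morphism i : zmod_morphism (@pullback i).
Proof. by move=> s t; exact: nat_compBl. Qed.
HB.instance Definition _ i :=
  GRing.isZmodMorphism.Build _ _ (@pullback i) (@pullback_is_zmod_morphism i).

Lemma pullback_cocycles i :
  {homo @pullback i : s / s \in cocycles Q B i >-> s \in cocycles P B i}.
Proof.
move=> s /cocycleP sd; apply/cocycleP.
by rewrite /pullback -nat_compA -fP.2 nat_compA sd nat_comp0l.
Qed.

Lemma pullback_coboundaries i :
  {homo @pullback i : s / s \in coboundaries Q B i >-> s \in coboundaries P B i}.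
Proof.
case: i => [s /eqP->|i s /coboundaryS[t ->]]; first by rewrite raddf0 rpred0.
apply/coboundaryS; exists (nat_comp t (f i)).
by rewrite /pullback -!nat_compA fP.2.
Qed.

Definition cohomology_map i : cohomology Q B i -> cohomology P B i :=
  subquotient_map (@pullback_cocycles i).

HB.instance Definition _ i := GRing.isZmodMorphism.Build _ _
  (@cohomology_map i)
  (subquotient_map_is_zmod_morphism (@pullback_cocycles i)
    (@pullback_coboundaries i)).

Lemma cohomology_mapE i (s : subgroup (cocycles Q B i)) :
  cohomology_map (subquotient_class _ s) =
  subquotient_class _ (subgroup_map (@pullback_cocycles i) s).
Proof. exact: subquotient_mapE (@pullback_coboundaries i) s. Qed.

End Comparison.

Lemma homotopic_coboundary (A B : functor) (P : resolution A)
    (f g : chain_map P P) i (s : nat_trans (P i) B) :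
  is_chain_map f -> is_chain_map g -> s \in cocycles P B i ->
  nat_comp s (f i) - nat_comp s (g i) \in coboundaries P B i.
Proof.
move=> fP gP /cocycleP sd; have [h] := chain_homotopy fP gP i.
set u := _ - nat_comp _ _ => uP.
have -> : nat_comp s (f i) - nat_comp s (g i) = nat_comp s u.
  by rewrite !nat_compBr nat_compA sd nat_comp0l subr0.
case: i s sd h @u uP => [|i] s _ h u uP.
  by rewrite [u]uP nat_comp0r; exact/eqP.
have [h' ->] := uP; apply/coboundaryS.
by exists (nat_comp s h'); rewrite nat_compA.
Qed.

Definition chain_id (A : functor) (P : resolution A) : chain_map P P :=
  fun i => @NatTrans (P i) (P i)
    (fun G => idfun : {additive P i G -> P i G}) (fun G H f x => erefl).

Lemma chain_id_is_chain_map (A : functor) (P : resolution A) :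
  is_chain_map (chain_id P).
Proof. by split=> [|i]; exact: nat_trans_ext. Qed.

Definition chain_comp (A : functor) (P Q R : resolution A) (g : chain_map Q R)
    (f : chain_map P Q) : chain_map P R := fun i => nat_comp (g i) (f i).

Lemma chain_comp_is_chain_map (A : functor) (P Q R : resolution A)
    (g : chain_map Q R) (f : chain_map P Q) :
  is_chain_map g -> is_chain_map f -> is_chain_map (chain_comp g f).
Proof.
move=> [g0 gS] [f0 fS]; split=> [|i]; rewrite /chain_comp.
  by rewrite nat_compA g0.
by rewrite nat_compA gS -[LHS]nat_compA fS nat_compA.
Qed.

Lemma cohomology_mapK (A B : functor) (P Q : resolution A)
    (f : chain_map P Q) (g : chain_map Q P) (fP : is_chain_map f)
    (gP : is_chain_map g) i :
  cancel (@cohomology_map A B P Q f fP i) (@cohomology_map A B Q P g gP i).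
Proof.
move=> q; have [s <-] := subquotient_class_surj q.
rewrite !cohomology_mapE; apply/subquotient_classP; rewrite /= /pullback.
rewrite -nat_compA.
have := homotopic_coboundary (chain_comp_is_chain_map fP gP)
  (chain_id_is_chain_map Q) (valP s).
by rewrite (_ : nat_comp _ (chain_id Q i) = val s)//; exact: nat_trans_ext.
Qed.

Theorem cohomology_iso (A B : functor) (P Q : resolution A) i :
  group_iso (cohomology P B i) (cohomology Q B i).
Proof.
have [f fP] := chain_map_exists Q P; have [g gP] := chain_map_exists P Q.
exists (@cohomology_map A B Q P f fP i).
by exists (@cohomology_map A B P Q g gP i); exact: cohomology_mapK.
Qed.

(** * Free groups *)

Section BasisElement.
Variables (G : groupType) (r : nat) (b : 'I_r -> G).

(** With a neutral element at 0 and beyond [r], the formulas for faces need no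
    case distinction at the two ends. *)
Definition basis_elt (j : nat) : G :=
  oapp b 1%g (if j is i.+1 then insub i else None).

Lemma basis_eltE (i : 'I_r) : basis_elt i.+1 = b i.
Proof. by rewrite /basis_elt valK. Qed.

End BasisElement.

Section FreeGroup.
Variable k : nat.

Definition word := seq (bool * nat).

Section Evaluation.
Variables (H : groupType) (h : nat -> H).

Definition eval_letter (i : nat) : H := if (0 < i <= k)%N then h i else 1%g.

Fixpoint eval_word (w : word) : H :=
  if w is (s, i) :: v then
    ((if s then eval_letter i else (eval_letter i)^-1) * eval_word v)%g
  else 1%g.

Lemma eval_word_cat v w : eval_word (v ++ w) = (eval_word v * eval_word w)%g.
Proof.
by elim: v => [|[s i] v IHv] /=; rewrite ?mul1g // IHv mulgA.
Qed.

Definition inv_word (w : word) : word := rev [seq (~~ p.1, p.2) | p <- w].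

Lemma eval_word_inv w : eval_word (inv_word w) = (eval_word w)^-1%g.
Proof.
elim: w => [|[s i] w IHw]; first by rewrite invg1.
rewrite /inv_word map_cons rev_cons -cats1 eval_word_cat IHw invgM /= mulg1.
by case: s => //=; rewrite invgK.
Qed.

End Evaluation.

(** Two words are identified when no assignment of the letters in a group
    distinguishes them. This congruence is the one generated by cancellation,
    and it makes the universal property immediate. *)
Definition word_equiv (v w : word) : bool :=
  `[< forall (H : groupType) (h : nat -> H), eval_word h v = eval_word h w >].

Lemma word_equivP v w : reflect
  (forall (H : groupType) (h : nat -> H), eval_word h v = eval_word h w)
  (word_equiv v w).
Proof. exact: asboolP. Qed.

Definition canon (w : word) : word := choose (word_equiv w) w.

Lemma canon_equiv w : word_equiv w (canon w).
Proof. by apply: chooseP; exact/word_equivP. Qed.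

Lemma eq_canon v w : word_equiv v w -> canon v = canon w.
Proof.
move=> /word_equivP vw; rewrite /canon (eq_choose (Q := word_equiv w)).
  by apply: choose_id; apply/word_equivP.
by move=> u; apply/word_equivP/word_equivP => uE H h; rewrite -uE vw.
Qed.

Lemma canonK w : canon (canon w) == canon w.
Proof. by apply/eqP/esym/eq_canon/canon_equiv. Qed.

(** The carrier has to lie in the universe of the carriers of free groups. This
    is why it consists of canonical words instead of being a quotient type, and
    why the letters are naturals, those outside [1..k] being evaluated to 1. *)
Definition free_group : Set := {w : word | canon w == w}.
HB.instance Definition _ := Choice.on free_group.

Definition word_class (w : word) : free_group := exist _ (canon w) (canonK w).

Lemma word_classP v w : word_class v = word_class w <->
  forall (H : groupType) (h : nat -> H), eval_word h v = eval_word h w.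
Proof.
split=> [/(congr1 val) /= vw H h|/word_equivP vw].
  rewrite (word_equivP _ _ (canon_equiv v)) vw.
  by rewrite -(word_equivP _ _ (canon_equiv w)).
by apply: val_inj; exact: eq_canon.
Qed.

Lemma word_class_surj (a : free_group) : exists w, word_class w = a.
Proof. by exists (val a); apply: val_inj; exact/eqP/(valP a). Qed.

Lemma eval_val (w : word) (H : groupType) (h : nat -> H) :
  eval_word h (val (word_class w)) = eval_word h w.
Proof. by rewrite -(word_equivP _ _ (canon_equiv w)). Qed.

Definition free_mul (a b : free_group) := word_class (val a ++ val b).
Definition free_inv (a : free_group) := word_class (inv_word (val a)).
Definition free_one := word_class [::].

Lemma free_mulE v w : free_mul (word_class v) (word_class w) = word_class (v ++ w).
Proof. by apply/word_classP => H h; rewrite !eval_word_cat !eval_val. Qed.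

Lemma free_invE w : free_inv (word_class w) = word_class (inv_word w).
Proof. by apply/word_classP => H h; rewrite !eval_word_inv eval_val. Qed.

Lemma free_mulA : associative free_mul.
Proof.
move=> a b c; have [u <-] := word_class_surj a; have [v <-] := word_class_surj b.
by have [w <-] := word_class_surj c; rewrite !free_mulE catA.
Qed.

Lemma free_mul1 : left_id free_one free_mul.
Proof. by move=> a; have [u <-] := word_class_surj a; rewrite free_mulE. Qed.

Lemma free_mulr1 : right_id free_one free_mul.
Proof.
by move=> a; have [u <-] := word_class_surj a; rewrite free_mulE cats0.
Qed.

Lemma free_mulV : left_inverse free_one free_inv free_mul.
Proof.
move=> a; have [u <-] := word_class_surj a; rewrite free_invE free_mulE.
by apply/word_classP => H h; rewrite eval_word_cat eval_word_inv mulVg.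
Qed.

Lemma free_mulrV : right_inverse free_one free_inv free_mul.
Proof.
move=> a; have [u <-] := word_class_surj a; rewrite free_invE free_mulE.
by apply/word_classP => H h; rewrite eval_word_cat eval_word_inv mulgV.
Qed.

HB.instance Definition _ :=
  isGroup.Build free_group free_mulA free_mul1 free_mulr1 free_mulV free_mulrV.

Definition letter (i : 'I_k) : free_group := word_class [:: (true, i.+1)].

Lemma free_group_basis : free_basis letter.
Proof.
move=> H h; pose f (a : free_group) := eval_word (basis_elt h) (val a).
have fM : {morph f : a b / (a * b)%g}.
  move=> a b; have [u <-] := word_class_surj a; have [v <-] := word_class_surj b.
  by rewrite [(_ * _)%g]free_mulE /f !eval_val eval_word_cat.
pose fI := monoid.isMultiplicative.Build _ _ f fM.
pose F : {multiplicative free_group -> H} := HB.pack f fI.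
exists F; split=> [i|g gE].
  by rewrite /= /f eval_val /= mulg1 /eval_letter ltn_ord basis_eltE.
apply: (multiplicative_ext (f := F) (g := g)) => a.
have [w <-] := word_class_surj a; rewrite [LHS]eval_val.
have letterE i : eval_letter (basis_elt h) i = g (word_class [:: (true, i)]).
  rewrite /eval_letter; case: ifP => [/andP[i0 ik]|ik].
    by case: i i0 ik => // i _ ik; rewrite (basis_eltE h (Ordinal ik)) -gE.
  rewrite -[LHS](mult_id1 g); congr (g _); apply/word_classP => K e /=.
  by rewrite /eval_letter ik mulg1.
elim: w => [|[s i] w IHw] /=; first by rewrite mult_id1.
have -> : word_class ((s, i) :: w) = (word_class [:: (s, i)] * word_class w)%g.
  by rewrite [RHS]free_mulE.
rewrite gmulfM IHw letterE; congr (_ * _)%g; case: s => //.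
by rewrite -mult_inv; congr (g _); rewrite [LHS]free_invE.
Qed.

HB.instance Definition _ := isFGFree.Build free_group
  (ex_intro _ k (ex_intro _ letter free_group_basis)).

End FreeGroup.

Arguments letter {k} i.

Section Basis.
Variables (G : groupType) (r : nat) (b : 'I_r -> G).
Hypothesis bP : free_basis b.

Section Lift.
Variables (H : groupType) (f : nat -> H).

Definition basis_lift : {multiplicative G -> H} :=
  projT1 (cid (bP (fun i => f i.+1))).

Lemma basis_liftE j : (0 < j <= r)%N -> basis_lift (basis_elt b j) = f j.
Proof.
case: j => // j jr; rewrite -[j]/(val (Ordinal jr)) basis_eltE /basis_lift.
by case: cid => g /= [gE _]; rewrite gE.
Qed.

End Lift.

Lemma basis_ext (H : groupType) (f g : {multiplicative G -> H}) :
  (forall j, (0 < j <= r)%N -> f (basis_elt b j) = g (basis_elt b j)) -> f = g.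
Proof.
move=> fg; have [h [_ huniq]] := bP (f \o b).
have <- : h = f by exact: huniq.
by apply: huniq => i /=; rewrite -!basis_eltE fg ?ltn_ord.
Qed.

End Basis.

(** * Fox calculus *)

Section GroupRingTheory.
Variable G : groupType.
Implicit Types (g h : G) (u v : group_ring G).

Lemma gr_of1 : gr_of (1%g : G) = 1.
Proof. by []. Qed.

Lemma gr_ofM g h : gr_of (g * h)%g = gr_of g * gr_of h.
Proof. by rewrite -gr_mul_of. Qed.

Lemma augmentation_of g : augmentation (gr_of g) = 1.
Proof. exact: liftU. Qed.

Lemma augmentation1 : augmentation (1 : group_ring G) = 1.
Proof. exact: augmentation_of. Qed.

Lemma augmentationD u v : augmentation (u + v) = augmentation u + augmentation v.
Proof. exact: raddfD. Qed.

Lemma augmentationM u v : augmentation (u * v) = augmentation u * augmentation v.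
Proof.
rewrite mulrC.
apply: (malg_ext (f := augmentation \o gr_mull v)
                 (g := augmentation v \*o augmentation)) => {u} g /=.
rewrite augmentation_of mulr1.
apply: (malg_ext (f := augmentation \o gr_mul (gr_of g)) (g := augmentation)).
by move=> h /=; rewrite gr_mul_of !augmentation_of.
Qed.

Lemma augmentation_idealP u :
  u \in augmentation_ideal G <-> augmentation u = 0.
Proof. by split=> /eqP. Qed.

End GroupRingTheory.

Section Affine.
Variable G : groupType.

(** The group of affine maps [v |-> v g + a] of the right module [Z[G]]; its
    sections over [G] are the crossed homomorphisms, which is what reduces the
    construction of Fox derivatives to the universal property of [G]. *)
Definition affine : Type := (G * group_ring G)%type.
HB.instance Definition _ := Choice.on affine.

Definition affine_mul (p q : affine) : affine :=
  ((p.1 * q.1)%g, p.2 * gr_of q.1 + q.2).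
Definition affine_one : affine := (1%g, 0).
Definition affine_inv (p : affine) : affine :=
  (p.1^-1%g, - (p.2 * gr_of p.1^-1%g)).

Lemma affine_mulA : associative affine_mul.
Proof.
move=> [g u] [h v] [k w]; rewrite /affine_mul /= mulgA; congr pair.
by rewrite gr_ofM mulrA mulrDl addrA.
Qed.

Lemma affine_mul1 : left_id affine_one affine_mul.
Proof. by move=> [g u]; rewrite /affine_mul /= mul1g mul0r add0r. Qed.

Lemma affine_mulr1 : right_id affine_one affine_mul.
Proof. by move=> [g u]; rewrite /affine_mul /= mulg1 mulr1 addr0. Qed.

Lemma affine_mulV : left_inverse affine_one affine_inv affine_mul.
Proof.
move=> [g u]; rewrite /affine_mul /= mulVg mulNr -mulrA -gr_ofM mulVg.
by rewrite mulr1 addNr.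
Qed.

Lemma affine_mulrV : right_inverse affine_one affine_inv affine_mul.
Proof. by move=> [g u]; rewrite /affine_mul /= mulgV addrN. Qed.

HB.instance Definition _ := isGroup.Build affine affine_mulA affine_mul1
  affine_mulr1 affine_mulV affine_mulrV.

Definition affine_fst (p : affine) : G := p.1.

Lemma affine_fstM : {morph affine_fst : p q / (p * q)%g}.
Proof. by []. Qed.
HB.instance Definition _ :=
  monoid.isMultiplicative.Build affine G affine_fst affine_fstM.

Section AffineSection.
Variable f : G -> group_ring G.
Hypothesis fM : forall g h, f (g * h)%g = f g * gr_of h + f h.

Definition affine_section (g : G) : affine := (g, f g).

Lemma affine_sectionM : {morph affine_section : g h / (g * h)%g}.
Proof. by move=> g h; rewrite /affine_section fM. Qed.

Definition affine_section_mul : {multiplicative G -> affine} :=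
  HB.pack affine_section
    (monoid.isMultiplicative.Build _ _ affine_section affine_sectionM).

End AffineSection.
End Affine.

Section Fox.
Variables (G : groupType) (r : nat) (b : 'I_r -> G).
Hypothesis bP : free_basis b.
Implicit Types (g h : G) (u v : group_ring G) (i j : nat).

Definition aug_gen j : group_ring G := gr_of (basis_elt b j) - 1.

Lemma augmentation_gen j : augmentation (aug_gen j) = 0.
Proof. by rewrite /aug_gen raddfB /= augmentation_of augmentation1 subrr. Qed.

(** The sections of the affine group given by crossed homomorphisms are
    homomorphisms, to which the universal property of the basis applies. *)
Lemma crossed_ext (f f' : G -> group_ring G) :
  (forall g h, f (g * h)%g = f g * gr_of h + f h) ->
  (forall g h, f' (g * h)%g = f' g * gr_of h + f' h) ->
  (forall j, (0 < j <= r)%N -> f (basis_elt b j) = f' (basis_elt b j)) ->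
  f =1 f'.
Proof.
move=> fM f'M ff' g.
have /(congr1 (fun F : {multiplicative G -> affine G} => F g)) :
    affine_section_mul fM = affine_section_mul f'M.
  by apply: (basis_ext bP) => j jr /=; rewrite /affine_section ff'.
by move=> /= [].
Qed.

Definition fox_hom j : {multiplicative G -> affine G} :=
  basis_lift bP (fun i => (basis_elt b i, (i == j)%:R) : affine G).

Lemma fox_hom_fst j g : (fox_hom j g).1 = g.
Proof.
have /(congr1 (fun F : {multiplicative G -> G} => F g)) :
    (@affine_fst G \o fox_hom j : {multiplicative G -> G}) = idfun.
  by apply: (basis_ext bP) => i ir /=; rewrite /fox_hom basis_liftE.
by [].
Qed.

Lemma fox_homM j g h :
  (fox_hom j (g * h)%g).2 = (fox_hom j g).2 * gr_of h + (fox_hom j h).2.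
Proof. by rewrite gmulfM /= fox_hom_fst. Qed.

Definition fox j : group_ring G -> group_ring G :=
  malg_lift (fun g => (fox_hom j g).2).
HB.instance Definition _ j := GRing.Additive.on (fox j).

Lemma fox_of j g : fox j (gr_of g) = (fox_hom j g).2.
Proof. exact: liftU. Qed.

Lemma fox_ofM j g h :
  fox j (gr_of (g * h)%g) = fox j (gr_of g) * gr_of h + fox j (gr_of h).
Proof. by rewrite !fox_of fox_homM. Qed.

Lemma fox1 j : fox j 1 = 0.
Proof.
have := fox_ofM j 1%g 1%g; rewrite mulg1 gr_of1 mulr1.
by move=> /(congr1 (+%R^~ (- fox j 1))); rewrite addrK subrr.
Qed.

Lemma fox_basis i j : (0 < i <= r)%N ->
  fox j (gr_of (basis_elt b i)) = (i == j)%:R.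
Proof. by move=> ir; rewrite fox_of /fox_hom basis_liftE. Qed.

Lemma fox_gen i j : (0 < i <= r)%N -> fox j (aug_gen i) = (i == j)%:R.
Proof. by move=> ir; rewrite /aug_gen raddfB /= fox_basis // fox1 subr0. Qed.

Lemma fox_out j u : ~~ (0 < j <= r)%N -> fox j u = 0.
Proof.
move=> jr; apply: (malg_ext (f := fox j) (g := \0)) => g /=.
apply: (crossed_ext (f := fun g => fox j (gr_of g)) (f' := fun=> 0)).
- exact: fox_ofM.
- by move=> _ h; rewrite mul0r addr0.
- by move=> i ir; rewrite fox_basis //; case: eqP jr => // <-; rewrite ir.
Qed.

Lemma foxM j u v : fox j (u * v) = fox j u * v + fox j v *~ augmentation u.
Proof.
apply: (malg_ext (f := fox j \o gr_mull v)
  (g := (gr_mull v \o fox j) \+ ( *~%R (fox j v) \o augmentation))) => {u} g.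
rewrite /= augmentation_of mulr1z.
apply: (malg_ext (f := fox j \o gr_mul (gr_of g))
  (g := gr_mul (fox j (gr_of g)) \+ fox j)) => {v} h /=.
by rewrite gr_mul_of fox_ofM.
Qed.

Lemma fox_genM i j v : (0 < i <= r)%N ->
  fox j (aug_gen i * v) = if i == j then v else 0.
Proof.
move=> ir; rewrite foxM fox_gen // augmentation_gen mulr0z addr0.
by case: eqP; rewrite ?mul1r ?mul0r.
Qed.

Lemma fox_sum (z : nat -> group_ring G) j : (0 < j <= r)%N ->
  fox j (\sum_(1 <= i < r.+1) aug_gen i * z i) = z j.
Proof.
move=> jr; rewrite raddf_sum big_nat /=.
rewrite (eq_bigr (fun i => if i == j then z i else 0)); last first.
  by move=> i ir; rewrite fox_genM.
rewrite -big_nat -big_mkcond /= (big_nat1_eq +%R) /=.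
by rewrite ltnS jr.
Qed.

(** Both sides are crossed homomorphisms on [G], up to the constant 1. With
    [fox_sum] this says that the augmentation ideal is the free right module on
    the elements [aug_gen j]. *)
Lemma foxE u :
  u = (augmentation u)%:~R + \sum_(1 <= j < r.+1) aug_gen j * fox j u.
Proof.
pose S v := \sum_(1 <= j < r.+1) aug_gen j * fox j v.
have SB : zmod_morphism S.
  by move=> v w; rewrite /S -sumrB; apply: eq_bigr => j _; rewrite raddfB mulrBr.
pose SA : {additive group_ring G -> group_ring G} :=
  HB.pack S (GRing.isZmodMorphism.Build _ _ S SB).
apply: (malg_ext (f := idfun)
  (g := ( *~%R (1 : group_ring G) \o augmentation) \+ SA)) => g /=.
rewrite augmentation_of; apply/eqP; rewrite addrC -subr_eq; apply/eqP.
apply: (crossed_ext (f := fun h => gr_of h - 1) (f' := fun h => S (gr_of h))).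
- by move=> h k; rewrite gr_ofM mulrBl mul1r addrA subrK.
- move=> h k; rewrite /S mulr_suml -big_split /=; apply: eq_bigr => j _.
  by rewrite fox_ofM mulrDr mulrA.
- move=> i ir; rewrite /S -[LHS]/(aug_gen i).
  rewrite (eq_big_nat _ _ (F2 := fun j => if j == i then aug_gen i else 0)).
    by rewrite -big_mkcond /= (big_nat1_eq +%R) ltnS ir.
  move=> j jr; rewrite fox_basis // eq_sym.
  by case: eqP => [->|_]; rewrite ?mulr1 ?mulr0.
Qed.

End Fox.

(** * The bar complex of a group *)

Fixpoint gpow (G : choiceType) (k : nat) : choiceType :=
  if k is l.+1 then (G * gpow G l)%type : choiceType else unit.

(** Tuples are read off functions on the naturals, the entries being numbered
    from 1 like the elements of a basis. *)
Fixpoint tup (G : choiceType) (k : nat) (f : nat -> G) : gpow G k :=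
  if k is l.+1 then (f 1, tup l (fun j => f j.+1)) else tt.

Fixpoint gmap (G H : choiceType) (f : G -> H) (k : nat) : gpow G k -> gpow H k :=
  if k is l.+1 then fun t => (f t.1, gmap f t.2) else id.

Lemma eq_tup (G : choiceType) k (f g : nat -> G) :
  (forall j, (0 < j <= k)%N -> f j = g j) -> tup k f = tup k g.
Proof.
elim: k f g => //= k IHk f g fg; congr pair; first exact: fg.
by apply: IHk => j /andP[_ jk]; exact: fg.
Qed.

Lemma tup_surj (G : groupType) k (t : gpow G k) : exists f, t = tup k f.
Proof.
elim: k t => [[]|k IHk [g t]]; first by exists (fun=> 1%g).
have [f ->] := IHk t; exists (fun j => if j is i.+2 then f i.+1 else g) => /=.
congr pair.
by apply: eq_tup => -[].
Qed.

Lemma gmap_tup (G H : choiceType) (h : G -> H) k (f : nat -> G) :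
  gmap h (tup k f) = tup k (h \o f).
Proof. by elim: k f => //= k IHk f; rewrite IHk. Qed.

Lemma gmap_id (G : choiceType) k : @gmap G G id k =1 id.
Proof. by elim: k => //= k IHk [g t]; rewrite IHk. Qed.

Lemma gmap_comp (G H K : choiceType) (g : H -> K) (f : G -> H) k :
  @gmap _ _ (g \o f) k =1 @gmap _ _ g k \o @gmap _ _ f k.
Proof. by elim: k => //= k IHk [h t]; rewrite /= IHk. Qed.

Lemma subrACA (V : zmodType) (x y z t : V) : x - y - (z - t) = x - z - (y - t).
Proof. by rewrite !opprB addrACA [RHS]addrACA [- y - z]addrC. Qed.

Section Bar.
Variable G : groupType.
Implicit Types (g h : G).

Definition chain k : zmodType := {malg int[gpow G k]}.

Definition act g {k} : gpow G k -> gpow G k :=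
  match k with 0 => id | l.+1 => fun t => ((g * t.1)%g, t.2) end.

Definition actC g {k} : chain k -> chain k :=
  malg_lift (fun t => << act g t >>).
HB.instance Definition _ g k := GRing.Additive.on (@actC g k).

Definition consC g {k} : chain k -> chain k.+1 :=
  malg_lift (fun t => << ((g, t) : gpow G k.+1) >>).
HB.instance Definition _ g k := GRing.Additive.on (@consC g k).

Definition tailC {k} : chain k.+1 -> chain k :=
  malg_lift (fun t : gpow G k.+1 => << t.2 >>).
HB.instance Definition _ k := GRing.Additive.on (@tailC k).

Fixpoint std {k} : gpow G k.+1 -> chain k :=
  match k return gpow G k.+1 -> chain k with
  | 0 => fun=> << (tt : gpow G 0) >>
  | l.+1 => fun t => << @act t.1 l.+1 t.2 >> - consC t.1 (@std l t.2)
  end.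

(** The differential of the standard free resolution of Z over Z[G], where G
    acts on the first entry of a tuple. *)
Definition stdC {k} : chain k.+1 -> chain k := malg_lift (@std k).
HB.instance Definition _ k := GRing.Additive.on (@stdC k).

(** The bar differential, with trivial coefficients: the first entry is
    dropped instead of acting. *)
Definition barC {k} : chain k.+1 -> chain k := tailC \- stdC.
HB.instance Definition _ k := GRing.Additive.on (@barC k).

Lemma actCE g k (t : gpow G k) : actC g << t >> = << act g t >>.
Proof. exact: liftU. Qed.

Lemma consCE g k (t : gpow G k) : consC g << t >> = << ((g, t) : gpow G k.+1) >>.
Proof. exact: liftU. Qed.

Lemma tailCE k g (t : gpow G k) : tailC << ((g, t) : gpow G k.+1) >> = << t >>.
Proof. exact: liftU. Qed.

Lemma stdCE k (t : gpow G k.+1) : stdC << t >> = std t.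
Proof. exact: liftU. Qed.

Lemma stdS g k (t : gpow G k.+1) :
  @std k.+1 (g, t) = actC g << t >> - consC g (std t).
Proof. by rewrite actCE. Qed.

Lemma actCB g k (c d : chain k) : actC g (c - d) = actC g c - actC g d.
Proof. exact: raddfB. Qed.

Lemma tailCB k (c d : chain k.+1) : tailC (c - d) = tailC c - tailC d.
Proof. exact: raddfB. Qed.

Lemma stdCB k (c d : chain k.+1) : stdC (c - d) = stdC c - stdC d.
Proof. exact: raddfB. Qed.

Lemma actC1 k (c : chain k) : actC 1%g c = c.
Proof.
apply: (malg_ext (f := actC 1%g) (g := idfun)) => t /=; rewrite actCE.
by case: k c t => //= k _ [g t]; rewrite mul1g.
Qed.

Lemma actC_cons g h k (c : chain k) : actC g (consC h c) = consC (g * h)%g c.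
Proof.
apply: (malg_ext (f := actC g \o consC h) (g := consC (g * h)%g)) => t.
by rewrite /= !consCE actCE.
Qed.

Lemma tailC_cons g k (c : chain k) : tailC (consC g c) = c.
Proof.
apply: (malg_ext (f := tailC \o consC g) (g := idfun)) => t.
by rewrite /= consCE tailCE.
Qed.

Lemma tailC_act g k (c : chain k.+1) : tailC (actC g c) = tailC c.
Proof.
apply: (malg_ext (f := tailC \o actC g) (g := tailC)) => -[h t].
by rewrite /= actCE !tailCE.
Qed.

Lemma actC_act g h k (c : chain k) : actC g (actC h c) = actC (g * h)%g c.
Proof.
apply: (malg_ext (f := actC g \o actC h) (g := actC (g * h)%g)) => t.
rewrite -[LHS]/(actC g (actC h (mkmalgU _ 1))) -[RHS]/(actC _ (mkmalgU _ 1)).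
rewrite !actCE.
by case: k t {c} => //= k [a t]; rewrite /= mulgA.
Qed.

Lemma stdC_act g k (c : chain k.+1) : stdC (actC g c) = actC g (stdC c).
Proof.
apply: (malg_ext (f := stdC \o actC g) (g := actC g \o stdC)) => -[h t].
rewrite -[LHS]/(stdC (actC g (mkmalgU _ 1))) -[RHS]/(actC g (stdC (mkmalgU _ 1))).
rewrite actCE !stdCE -[act _ _]/((g * h)%g, t).
case: k c t => [|k] _ t; first by rewrite actCE.
by rewrite !stdS actCB actC_act actC_cons.
Qed.

Lemma stdC_cons g k (c : chain k.+1) :
  stdC (consC g c) = actC g c - consC g (stdC c).
Proof.
apply: (malg_ext (f := stdC \o consC g)
                 (g := actC g \- (consC g \o stdC))) => t.
by rewrite /= consCE !stdCE actCE.
Qed.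

Lemma stdC_cons0 g (c : chain 0) : stdC (consC g c) = actC g c.
Proof.
apply: (malg_ext (f := stdC \o consC g) (g := actC g)) => -[].
by rewrite /= consCE stdCE actCE.
Qed.

Lemma stdC_stdC k (c : chain k.+2) : stdC (stdC c) = 0.
Proof.
elim: k c => [|k IHk] c;
    apply: (malg_ext (f := stdC \o stdC) (g := \0)) => {c} -[g t];
    rewrite -[LHS]/(stdC (stdC (mkmalgU _ 1))) -[RHS]/0;
    rewrite stdCE stdS stdCB stdC_act stdCE.
  by rewrite stdC_cons0 subrr.
by rewrite stdC_cons -stdCE IHk raddf0 subr0 subrr.
Qed.

(** The standard resolution is contracted by inserting the neutral element in
    front. *)
Lemma stdC_exact k (c : chain k.+1) : stdC c = 0 -> stdC (consC 1%g c) = c.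
Proof. by move=> c0; rewrite stdC_cons c0 raddf0 actC1 subr0. Qed.

Lemma tailC_std k (c : chain k.+2) : tailC (stdC c) = barC (tailC c).
Proof.
apply: (malg_ext (f := tailC \o stdC) (g := barC \o tailC)) => -[g [h t]].
rewrite -[LHS]/(tailC (stdC (mkmalgU _ 1))).
rewrite -[RHS]/(tailC (tailC (mkmalgU _ 1)) - stdC (tailC (mkmalgU _ 1))).
by rewrite !stdCE tailCE stdS tailCB tailC_act tailC_cons stdCE.
Qed.

Lemma barC_barC k (c : chain k.+2) : barC (barC c) = 0.
Proof.
by rewrite -[c in LHS](tailC_cons 1%g) -!tailC_std stdC_stdC raddf0.
Qed.

Definition tensor {k} (y : gpow G k) : group_ring G -> chain k.+1 :=
  malg_lift (fun g => << ((g, y) : gpow G k.+1) >>).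
HB.instance Definition _ k y := GRing.Additive.on (@tensor k y).

Lemma tensor_of g k (y : gpow G k) :
  tensor y (gr_of g) = << ((g, y) : gpow G k.+1) >>.
Proof. exact: liftU. Qed.

Lemma tensor_mul g (u : group_ring G) k (y : gpow G k) :
  tensor y (gr_of g * u) = actC g (tensor y u).
Proof.
apply: (malg_ext (f := tensor y \o gr_mul (gr_of g)) (g := actC g \o tensor y)).
by move=> h; rewrite /= gr_mul_of !tensor_of actCE.
Qed.

Section Exactness.
Variables (r : nat) (b : 'I_r -> G) (bP : free_basis b).
Let x j := basis_elt b j.

(** Fox derivatives act on the first entry of a chain: a chain of positive
    length is an element of a free left Z[G]-module. *)
Definition foxC j {k} : chain k.+1 -> chain k.+1 :=
  malg_lift (fun t : gpow G k.+1 => tensor t.2 (fox bP j (gr_of t.1))).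
HB.instance Definition _ j k := GRing.Additive.on (@foxC j k).

Lemma foxCE j k g (t : gpow G k) :
  foxC j << ((g, t) : gpow G k.+1) >> = tensor t (fox bP j (gr_of g)).
Proof. exact: liftU. Qed.

Lemma foxCB j k (c d : chain k.+1) : foxC j (c - d) = foxC j c - foxC j d.
Proof. exact: raddfB. Qed.

(** The elements of a free Z[G]-module killed by trivialising the action are
    the sums of this form, with a unique [z]. *)
Definition gen_sum k (z : nat -> chain k) : chain k :=
  \sum_(1 <= j < r.+1) (actC (x j) (z j) - z j).

Lemma foxC_split k (c : chain k.+1) :
  c = consC 1%g (tailC c) +
      gen_sum (fun j => foxC j c).
Proof.
pose F (c : chain k.+1) := gen_sum (fun j => foxC j c).
have FB : zmod_morphism F.
  move=> u v; rewrite /F /gen_sum -sumrB; apply: eq_bigr => j _.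
  by rewrite foxCB actCB; exact: subrACA.
pose S : {additive chain k.+1 -> chain k.+1} :=
  HB.pack F (GRing.isZmodMorphism.Build _ _ F FB).
apply: (malg_ext (f := idfun) (g := (consC 1%g \o tailC) \+ S)) => -[g t].
rewrite -[RHS]/(consC 1%g (tailC (mkmalgU _ 1)) +
  gen_sum (fun j => foxC j (mkmalgU _ 1))).
rewrite tailCE consCE -!tensor_of [LHS]/= {1}(foxE bP (gr_of g)).
rewrite augmentation_of raddfD raddf_sum; congr (_ + _).
apply: eq_bigr => j _; rewrite tensor_of foxCE -tensor_mul -raddfB.
by congr tensor; rewrite /aug_gen mulrBl mul1r.
Qed.

Lemma foxC_act i j k (c : chain k.+1) : (0 < i <= r)%N ->
  foxC j (actC (x i) c - c) = if i == j then c else 0.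
Proof.
move=> ir.
have basisE g (t : gpow G k) : foxC j (actC (x i) << (g, t) : gpow G k.+1 >> -
    << (g, t) : gpow G k.+1 >>) = tensor t ((i == j)%:R * gr_of g).
  rewrite foxCB actCE !foxCE fox_ofM -(fox_basis bP) // -raddfB.
  by congr tensor; exact: addrK.
case: eqP basisE => _ basisE.
  apply: (malg_ext (f := foxC j \o (actC (x i) \- idfun)) (g := idfun)) => -[g t].
  by apply: etrans (basisE g t) _; rewrite mul1r tensor_of.
apply: (malg_ext (f := foxC j \o (actC (x i) \- idfun)) (g := \0)) => -[g t].
by apply: etrans (basisE g t) _; rewrite mul0r raddf0.
Qed.

Lemma foxC_gen_sum j k (z : nat -> chain k.+1) : (0 < j <= r)%N ->
  foxC j (gen_sum z) = z j.
Proof.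
move=> jr; rewrite /gen_sum raddf_sum big_nat.
have zE i : (0 < i < r.+1)%N -> foxC j (actC (x i) (z i) - z i) =
    if i == j then z i else 0.
  by move=> ir; rewrite foxC_act.
rewrite (eq_bigr _ zE) -big_nat -big_mkcond (big_nat1_eq +%R).
by rewrite ltnS jr.
Qed.

Lemma stdC_gen_sum k (z : nat -> chain k.+1) :
  stdC (gen_sum z) = gen_sum (fun j => stdC (z j)).
Proof.
rewrite /gen_sum raddf_sum; apply: eq_bigr => j _.
by rewrite -stdC_act -stdCB.
Qed.

Lemma tailC_gen_sum k (z : nat -> chain k.+1) : tailC (gen_sum z) = 0.
Proof.
rewrite /gen_sum raddf_sum big1 // => j _.
by rewrite -[LHS]/(tailC _) tailCB tailC_act subrr.
Qed.

Lemma eq_gen_sum k (z z' : nat -> chain k) :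
  (forall j, (0 < j <= r)%N -> z j = z' j) -> gen_sum z = gen_sum z'.
Proof. by move=> zz'; apply: eq_big_nat => j jr; rewrite zz'. Qed.

(** Dimension shifting in elements. The lift [v] to the standard resolution of
    the boundary of [c] is trivial after trivialising the action, hence a
    [gen_sum]. Its coordinates are cycles, because the ones of a [gen_sum] are
    unique; as the standard resolution is exact, they bound some [w j], and
    [c] can be corrected by the [gen_sum] of these to a cycle. *)
Lemma barC_exact k (c : chain k.+2) : barC c = 0 -> exists e, barC e = c.
Proof.
move=> c0; pose v := stdC (consC 1%g c); pose y j := foxC j v.
have vE : v = gen_sum y.
  by rewrite [LHS]foxC_split tailC_std tailC_cons c0 raddf0 add0r.
have y0 j : (0 < j <= r)%N -> stdC (y j) = 0.
  move=> jr; rewrite -(foxC_gen_sum (fun j => stdC (y j)) jr) -stdC_gen_sum.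
  by rewrite -vE stdC_stdC raddf0.
pose w j := consC 1%g (y j); pose e := consC 1%g c - gen_sum w.
have e0 : stdC e = 0.
  rewrite /e stdCB stdC_gen_sum -/v {1}vE.
  by rewrite (eq_gen_sum (fun j jr => stdC_exact (y0 j jr))) subrr.
exists e; rewrite -[e in LHS](tailC_cons 1%g) -tailC_std stdC_exact //.
by rewrite /e tailCB tailC_gen_sum tailC_cons subr0.
Qed.

End Exactness.
End Bar.

Section BarMap.
Variables (G H : groupType) (f : {multiplicative G -> H}).

Definition mapC {k} : chain G k -> chain H k :=
  malg_lift (fun t => << gmap f t >>).
HB.instance Definition _ k := GRing.Additive.on (@mapC k).

Lemma mapCE k (t : gpow G k) : mapC << t >> = << gmap f t >>.
Proof. exact: liftU. Qed.

Lemma mapCB k (c d : chain G k) : mapC (c - d) = mapC c - mapC d.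
Proof. exact: raddfB. Qed.

Lemma mapC_cons g k (c : chain G k) : mapC (consC g c) = consC (f g) (mapC c).
Proof.
apply: (malg_ext (f := mapC \o consC g) (g := consC (f g) \o mapC)) => t.
rewrite -[LHS]/(mapC (consC g (mkmalgU _ 1))).
rewrite -[RHS]/(consC (f g) (mapC (mkmalgU _ 1))).
by rewrite consCE !mapCE consCE.
Qed.

Lemma mapC_act g k (c : chain G k) : mapC (actC g c) = actC (f g) (mapC c).
Proof.
apply: (malg_ext (f := mapC \o actC g) (g := actC (f g) \o mapC)) => t.
rewrite -[LHS]/(mapC (actC g (mkmalgU _ 1))).
rewrite -[RHS]/(actC (f g) (mapC (mkmalgU _ 1))).
rewrite actCE !mapCE actCE.
by case: k c t => //= k _ t; rewrite gmulfM.
Qed.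

Lemma mapC_std k (c : chain G k.+1) : mapC (stdC c) = stdC (mapC c).
Proof.
apply: (malg_ext (f := @mapC k \o @stdC G k) (g := @stdC H k \o @mapC k.+1)) => t.
rewrite -[LHS]/(mapC (stdC (mkmalgU _ 1))).
rewrite -[RHS]/(stdC (mapC (mkmalgU _ 1))).
rewrite mapCE !stdCE; elim: k t {c} => [|k IHk] [g t]; first exact: mapCE.
by rewrite !stdS mapCB mapC_act mapC_cons mapCE IHk.
Qed.

Lemma mapC_tail k (c : chain G k.+1) : mapC (tailC c) = tailC (mapC c).
Proof.
apply: (malg_ext (f := @mapC k \o @tailC G k)
                 (g := @tailC H k \o @mapC k.+1)) => -[g t].
rewrite -[LHS]/(mapC (tailC (mkmalgU _ 1))).
rewrite -[RHS]/(tailC (mapC (mkmalgU _ 1))).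
by rewrite tailCE !mapCE tailCE.
Qed.

Lemma mapC_bar k (c : chain G k.+1) : mapC (barC c) = barC (mapC c).
Proof. by rewrite mapCB mapC_tail mapC_std. Qed.

End BarMap.

Section Faces.
Variable G : groupType.

(** The face [i] of the nerve of [G]; on a tuple of length [k + 1], the faces 0
    and [k + 1] drop the first and the last entry. *)
Definition face (i : nat) (f : nat -> G) (j : nat) : G :=
  if (j < i)%N then f j else if j == i then (f j * f j.+1)%g else f j.+1.

Lemma consC_tup g k (f : nat -> G) :
  consC g << tup k f >> = << tup k.+1 (fun j => if j is i.+2 then f i.+1 else g) >>.
Proof.
rewrite consCE; congr mkmalgU; congr pair; apply: eq_tup => -[]//.
Qed.

Lemma oppr_sign i : - (-1) ^+ i = (-1) ^+ i.+1 :> int.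
Proof. by rewrite exprS mulN1r. Qed.

Lemma consC_sum g k n (c : nat -> chain G k) (z : nat -> int) :
  consC g (\sum_(i < n) c i *~ z i) = \sum_(i < n) consC g (c i) *~ z i.
Proof.
apply: etrans (raddf_sum (consC g) _ _ _) _; apply: eq_bigr => i _.
exact: raddfMz.
Qed.

Lemma std_tup k (f : nat -> G) :
  std (tup k.+1 f) = \sum_(i < k.+1) << tup k (face i.+1 f) >> *~ (-1) ^+ i.
Proof.
elim: k f => [|k IHk] f; first by rewrite big_ord1.
rewrite -[tup k.+2 f]/((f 1%N, tup k.+1 (fun j => f j.+1)) : gpow G k.+2).
rewrite stdS IHk [RHS]big_ord_recl mulr1z actCE.
rewrite (consC_sum _ _ (fun i => << tup k (face i.+1 _) >>) (fun i => (-1) ^+ i)).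
rewrite -sumrN; apply: f_equal2.
  congr mkmalgU; congr pair; apply: eq_tup => j /andP[j0 _]; rewrite /face.
  by case: j j0 => // -[].
apply: eq_bigr => i _; rewrite -mulrNz oppr_sign consC_tup.
by rewrite (@eq_tup G k.+1 _ (face (lift ord0 i).+1 f)) // => -[|[|j]].
Qed.

Lemma barC_tup k (f : nat -> G) :
  barC << tup k.+1 f >> =
    \sum_(i < k.+2) << tup k (face i f) >> *~ (-1) ^+ i.
Proof.
rewrite big_ord_recl mulr1z -[LHS]/(tailC _ - stdC _) stdCE std_tup tailCE.
rewrite -sumrN; apply: f_equal2.
  by congr mkmalgU; apply: eq_tup => -[].
by apply: eq_bigr => i _; rewrite -mulrNz oppr_sign.
Qed.

End Faces.

Section BarFunctor.
Variable k : nat.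

Lemma mapC_id (G : fgFreeGroupType) (c : chain G k) :
  mapC (idfun : {multiplicative G -> G}) c = c.
Proof.
apply: (malg_ext (f := mapC _) (g := idfun)) => t.
by apply: etrans (mapCE _ _) _; rewrite gmap_id.
Qed.

Lemma mapC_comp (G H K : fgFreeGroupType) (g : {multiplicative H -> K})
    (f : {multiplicative G -> H}) (c : chain G k) :
  mapC (g \o f : {multiplicative G -> K}) c = mapC g (mapC f c).
Proof.
apply: (malg_ext (f := mapC _) (g := mapC g \o mapC f)) => t.
rewrite -[RHS]/(mapC g (mapC f (mkmalgU _ 1))) !mapCE.
by apply: etrans (mapCE _ _) _; rewrite gmap_comp.
Qed.

Definition bar : functor :=
  @Functor (fun G => chain G k)
    (fun G H f => @mapC G H f k : {additive chain G k -> chain H k})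
    mapC_id mapC_comp.

Definition gen (j : nat) : free_group k := basis_elt letter j.

Definition free_lift (H : groupType) (f : nat -> H) :
    {multiplicative free_group k -> H} :=
  basis_lift (@free_group_basis k) f.

Lemma free_liftE (H : groupType) (f : nat -> H) j :
  (0 < j <= k)%N -> free_lift f (gen j) = f j.
Proof. exact: basis_liftE. Qed.

(** The universal element for which [bar k] is represented by [free_group k]. *)
Definition univ : bar (free_group k) := << tup k gen >>.

Lemma gpow_univ (G : groupType) (t : gpow G k) :
  exists f : {multiplicative free_group k -> G}, gmap f (tup k gen) = t.
Proof.
have [f ->] := tup_surj t; exists (free_lift f); rewrite gmap_tup.
by apply: eq_tup => j jk; exact: free_liftE.
Qed.

Definition tup_hom (G : groupType) (t : gpow G k) :
    {multiplicative free_group k -> G} := projT1 (cid (gpow_univ t)).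

Lemma tup_homK (G : groupType) (t : gpow G k) :
  gmap (tup_hom t) (tup k gen) = t.
Proof. exact: projT2 (cid (gpow_univ t)). Qed.

Lemma free_ext (H : groupType) (f g : {multiplicative free_group k -> H}) :
  (forall j, (0 < j <= k)%N -> f (gen j) = g (gen j)) -> f = g.
Proof. exact: (basis_ext (@free_group_basis k)). Qed.

Lemma tup_inj (G : choiceType) (f g : nat -> G) :
  tup k f = tup k g -> forall j, (0 < j <= k)%N -> f j = g j.
Proof.
elim: k f g => [|l IHl] f g; first by move=> _ [].
by move=> [fg /IHl fg1] [|[|j]] // jl; exact: (fg1 j.+1).
Qed.

Lemma tup_hom_unique (G : groupType) (f : {multiplicative free_group k -> G}) :
  tup_hom (gmap f (tup k gen)) = f.
Proof.
apply: free_ext; apply: tup_inj.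
by have := tup_homK (gmap f (tup k gen)); rewrite !gmap_tup.
Qed.

Lemma barE (G H : fgFreeGroupType) (f : {multiplicative G -> H}) (t : gpow G k) :
  fmap bar f << t >> = << gmap f t >>.
Proof. exact: mapCE. Qed.

Lemma bar_ext (B : functor) (s t : nat_trans bar B) :
  s (free_group k) univ = t (free_group k) univ -> s = t.
Proof.
move=> st; apply: nat_trans_ext => G; apply: malg_ext => u.
by rewrite -(tup_homK u) -barE !ncompE st.
Qed.

Section Yoneda.
Variables (B : functor) (y : B (free_group k)).

Definition yoneda_fun (G : fgFreeGroupType) : bar G -> B G :=
  malg_lift (fun t : gpow G k => fmap B (tup_hom t) y).
HB.instance Definition _ G := GRing.Additive.on (@yoneda_fun G).

Lemma yoneda_funE (G : fgFreeGroupType) (t : gpow G k) :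
  yoneda_fun << t >> = fmap B (tup_hom t) y.
Proof. exact: liftU. Qed.

Lemma yoneda_nat (G H : fgFreeGroupType) (f : {multiplicative G -> H}) x :
  @yoneda_fun H (fmap bar f x) = fmap B f (@yoneda_fun G x).
Proof.
apply: (malg_ext (f := @yoneda_fun H \o fmap bar f)
                 (g := fmap B f \o @yoneda_fun G)) => t.
rewrite -[LHS]/(@yoneda_fun H (fmap bar f (mkmalgU _ 1))).
rewrite -[RHS]/(fmap B f (@yoneda_fun G (mkmalgU _ 1))).
rewrite barE !yoneda_funE -fmap_comp; congr (fmap B _ y).
rewrite -[t in LHS]tup_homK -[RHS]tup_hom_unique; congr tup_hom.
by rewrite !gmap_tup.
Qed.

Definition yoneda : nat_trans bar B :=
  @NatTrans bar B (fun G => @yoneda_fun G : {additive bar G -> B G}) yoneda_nat.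

Lemma yonedaE : yoneda (free_group k) univ = y.
Proof.
apply: etrans (yoneda_funE _) _.
rewrite (_ : tup_hom _ = idfun) ?fmap_id //.
by rewrite -[RHS]tup_hom_unique gmap_tup.
Qed.

End Yoneda.

Lemma bar_projective : projective bar.
Proof.
move=> F E p f p_epi; have [y yE] := p_epi _ (f _ univ).
exists (yoneda y); apply: bar_ext.
by rewrite -yE /= -[RHS]/(p _ y) -[in RHS](yonedaE y).
Qed.

End BarFunctor.

(** * The bar resolution of the abelianization functor *)

Lemma commutator_cancel (V : zmodType) (a b c d : V) :
  a + b - c + (d - a) - (d - c) = b.
Proof.
rewrite opprB !addrA (ACl ((1*5)*(4*7)*(6*3)*2)%AC) /=.
by rewrite !subrr !add0r ?addrA.
Qed.

Lemma quotient_cancel (V : zmodType) (c d g h h' gh : V) :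
  c - g - (d - h) + (g + h' - gh) - (h + h') = c - d - gh.
Proof.
rewrite opprB opprD !addrA (ACl ((5*2)*(3*8)*(6*9)*(1*4*7))%AC) /=.
by rewrite !subrr !add0r ?addrA.
Qed.

Section AbAugmentation.
Variable G : groupType.

Definition ab_aug : chain G 1 -> abelianization G :=
  malg_lift (fun t : gpow G 1 => ab_class t.1).
HB.instance Definition _ := GRing.Additive.on ab_aug.

Definition single (g : G) : chain G 1 := << ((g, tt) : gpow G 1) >>.

Lemma ab_aug_single g : ab_aug (single g) = ab_class g.
Proof. exact: liftU. Qed.

Lemma barC_pair g h :
  barC << ((g, (h, tt)) : gpow G 2) >> = single g + single h - single (g * h)%g.
Proof.
rewrite -[LHS]/(tailC _ - stdC _) stdCE tailCE stdS actCE.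
rewrite -[std _]/(mkmalgU (tt : gpow G 0) 1) consCE opprB addrA.
by rewrite [_ + << _ >>]addrC.
Qed.

Lemma ab_aug_bar (c : chain G 2) : ab_aug (barC c) = 0.
Proof.
apply: (malg_ext (f := ab_aug \o @barC G 1) (g := \0)) => -[g [h []]].
rewrite -[LHS]/(ab_aug (barC (mkmalgU _ 1))) barC_pair raddfB raddfD.
by rewrite /= !ab_aug_single ab_classM subrr.
Qed.

Definition boundary : zmodClosed (chain G 1) := im_pred (@barC G 1).

Lemma single_boundary g h :
  single g + single h - single (g * h)%g \in boundary.
Proof.
rewrite -barC_pair; apply/asboolP.
by exists << ((g, (h, tt)) : gpow G 2) >>.
Qed.

Lemma single1_boundary : single 1%g \in boundary.
Proof. by have := single_boundary 1 1; rewrite mulg1 addrK. Qed.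

Lemma singleM_boundary g h : single g \in boundary -> single h \in boundary ->
  single (g * h)%g \in boundary.
Proof.
move=> Bg Bh; have := rpredB (rpredD Bg Bh) (single_boundary g h).
by rewrite opprB addrC subrK.
Qed.

Lemma singleV_boundary g : single g + single g^-1%g \in boundary.
Proof.
have := rpredD (single_boundary g g^-1%g) single1_boundary.
by rewrite mulgV subrK.
Qed.

Lemma derived_boundary g : derived g -> single g \in boundary.
Proof.
elim=> {g} [g h||g h _ Bg _ Bh|g _ Bg].
- have gh := single_boundary (h * g)%g [~ g, h].
  have hg := single_boundary h g; have hg' := single_boundary g h.
  have E : (h * g * [~ g, h])%g = (g * h)%g.
    by rewrite /commg /conjg !mulgA mulgK mulgV mul1g.
  have := rpredB (rpredD gh hg) hg'.
  by rewrite E [single h + _]addrC commutator_cancel.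
- exact: single1_boundary.
- exact: singleM_boundary.
- by have := rpredB (singleV_boundary g) Bg; rewrite addrC addKr.
Qed.

(** Modulo boundaries every chain is a single group element, since addition
    becomes multiplication. *)
Definition single_mod : {pred chain G 1} :=
  fun c => `[< exists g, c - single g \in boundary >].

Lemma single_mod_closed : zmod_closed single_mod.
Proof.
split=> [|c d /asboolP[g cg] /asboolP[h dh]]; apply/asboolP.
  by exists 1%g; rewrite sub0r rpredN single1_boundary.
exists (g * h^-1)%g; have := rpredB cg dh.
have gh := single_boundary g h^-1%g; have hV := singleV_boundary h.
by move=> /rpredD/(_ gh)/rpredB/(_ hV); rewrite quotient_cancel.
Qed.
HB.instance Definition _ :=
  GRing.isZmodClosed.Build _ single_mod single_mod_closed.

Lemma single_modP c : exists g, c - single g \in boundary.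
Proof.
suff: c \in single_mod by move/asboolP.
rewrite [c]monalgE.
apply: rpred_sum => -[g []] _.
have -> : << c@_(g, tt) *g (g, tt) >> = single g *~ c@_(g, tt).
  by rewrite -(raddfMz (mkmalgU _)) intz.
by apply: rpredMz; apply/asboolP; exists g; rewrite subrr rpred0.
Qed.

Lemma ab_aug_exact c : ab_aug c = 0 <-> exists e : chain G 2, barC e = c.
Proof.
split=> [c0|[e <-]]; last exact: ab_aug_bar.
have [g cg] := single_modP c; have /asboolP[e eE] := cg.
have g0 : single g \in boundary.
  apply: derived_boundary; rewrite -[g]divg1; apply/ab_classP.
  have := ab_aug_bar e; rewrite eE raddfB /= c0 sub0r ab_aug_single.
  by move/eqP; rewrite oppr_eq0 => /eqP.
by have := rpredD cg g0; rewrite subrK => /asboolP.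
Qed.

Lemma ab_aug_surj a : exists c, ab_aug c = a.
Proof.
by have [g <-] := ab_class_surj a; exists (single g); exact: ab_aug_single.
Qed.

End AbAugmentation.

Lemma ab_aug_nat (G H : fgFreeGroupType) (f : {multiplicative G -> H}) x :
  ab_aug (fmap (bar 1) f x) = fmap ab f (ab_aug x).
Proof.
apply: (malg_ext (f := @ab_aug H \o fmap (bar 1) f)
                 (g := fmap ab f \o @ab_aug G)) => -[g []].
rewrite -[LHS]/(ab_aug (fmap (bar 1) f (mkmalgU _ 1))) barE.
rewrite -[RHS]/(abelianization_map f (ab_aug (single g))).
by rewrite ab_aug_single abelianization_mapE ab_aug_single.
Qed.

Definition bar_aug : nat_trans (bar 1) ab :=
  @NatTrans (bar 1) ab (fun G => @ab_aug G : {additive bar 1 G -> ab G})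
    ab_aug_nat.

Definition bar_diff k : nat_trans (bar k.+1) (bar k) :=
  @NatTrans (bar k.+1) (bar k) (fun G => @barC G k : {additive _ -> _})
    (fun G H f x => esym (mapC_bar f x)).

Lemma bar_diff_diff k : nat_comp (bar_diff k) (bar_diff k.+1) = 0.
Proof. by apply: nat_trans_ext => G x; exact: barC_barC. Qed.

Lemma bar_diff_exact k : exact_at (bar_diff k.+2) (bar_diff k.+1).
Proof.
move=> G y; split=> [|[x <-]]; last exact: barC_barC.
have [r [b bP]] := @fg_freeP G; exact: (barC_exact bP).
Qed.

(** In the bar complex the differential from degree 1 to degree 0 is 0, so that
    truncation leaves the homology in degree 1, the abelianization, unchanged. *)
Definition bar_resolution : resolution ab :=
  @Resolution ab (fun i => bar i.+1) (fun i => bar_diff i.+1) bar_aug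
    (fun i => @bar_projective i.+1) (fun G => @ab_aug_surj G)
    (fun G y => ab_aug_exact y) (fun i => @bar_diff_exact i).

(** * Cochains on the bar resolution *)

Definition coface k (i : nat) : {multiplicative free_group k -> free_group k.+1} :=
  free_lift k (face i (gen k.+1)).

Section Cochains.
Variable B : functor.

(** Transported along the Yoneda isomorphism, the differential of cochains is
    the alternating sum of the coface maps of the cosimplicial group formed by
    the free groups. *)
Definition cobar k (y : B (free_group k)) : B (free_group k.+1) :=
  \sum_(i < k.+2) fmap B (coface k i) y *~ (-1) ^+ i.

Lemma cobar_is_zmod_morphism k : zmod_morphism (@cobar k).
Proof.
move=> x y; rewrite /cobar -sumrB; apply: eq_bigr => i _.
by rewrite raddfB mulrzBl.
Qed.
HB.instance Definition _ k :=
  GRing.isZmodMorphism.Build _ _ (@cobar k) (@cobar_is_zmod_morphism k).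

Lemma yoneda_cobar k (y : B (free_group k)) :
  yoneda (cobar y) = nat_comp (yoneda y) (bar_diff k).
Proof.
apply: bar_ext; rewrite yonedaE.
rewrite -[RHS]/(yoneda_fun y (barC (mkmalgU _ 1))) barC_tup.
rewrite (raddf_sum (@yoneda_fun _ _ y (free_group k.+1))); apply: eq_bigr => i _.
rewrite raddfMz; congr (_ *~ _); apply: etrans (esym (yoneda_funE y _)).
congr (fmap B _ y); rewrite -[LHS]tup_hom_unique gmap_tup; congr tup_hom.
by apply: eq_tup => j jk; exact: free_liftE.
Qed.

Lemma cobar_cobar k (y : B (free_group k)) : cobar (cobar y) = 0.
Proof.
rewrite -[LHS]yonedaE !yoneda_cobar -nat_compA bar_diff_diff.
by rewrite nat_comp0r.
Qed.

End Cochains.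

Section Cohomology.
Variables (B : functor) (i : nat).
Hypothesis B0 : forall x : B (free_group 0), x = 0.

Lemma bar_yoneda k (s : nat_trans (bar k) B) : s = yoneda (s _ (univ k)).
Proof. by apply: bar_ext; rewrite yonedaE. Qed.

Lemma bar_cocycleP (s : nat_trans (bar i.+1) B) :
  s \in cocycles bar_resolution B i <-> cobar (s _ (univ i.+1)) = 0.
Proof.
split=> [/eqP s0|s0].
  have := yoneda_cobar (s _ (univ i.+1)); rewrite -bar_yoneda [RHS]s0.
  by move=> E; rewrite -[LHS]yonedaE E.
apply/eqP; rewrite -[LHS]/(nat_comp s (bar_diff i.+1)) [s]bar_yoneda.
by rewrite -yoneda_cobar s0; apply: bar_ext; rewrite yonedaE.
Qed.

(** In degree 0, where only 0 is a coboundary, this holds as [B] is reduced. *)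
Lemma bar_coboundaryP (s : nat_trans (bar i.+1) B) :
  s \in coboundaries bar_resolution B i <->
  exists x, s _ (univ i.+1) = cobar x.
Proof.
case: i s => [|j] s; last first.
  split=> [/asboolP[t <-]|[x sx]].
    exists (t _ (univ j.+1)); rewrite -[RHS]yonedaE yoneda_cobar -bar_yoneda.
    by [].
  apply/asboolP; exists (yoneda x); rewrite -[LHS]/(nat_comp _ (bar_diff j.+1)).
  by rewrite -yoneda_cobar -sx -bar_yoneda.
split=> [/eqP->|[x sx]]; first by exists 0; rewrite raddf0.
by apply/eqP/bar_ext; rewrite sx (B0 x) raddf0.
Qed.

Lemma bar_cohomology_trivial :
  (forall y : B (free_group i.+1), cobar y = 0 -> exists x, y = cobar x) ->
  group_iso (cohomology bar_resolution B i) trivial_group.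
Proof.
move=> exact_i; exists \0; exists (fun=> 0) => q; last by apply/matrixP => ? [].
have [s <-] := subquotient_class_surj q.
have [x sx] := exact_i _ ((bar_cocycleP _).1 (valP s)).
rewrite -[LHS](subrr (subquotient_class _ s)) -subquotient_classB subrr.
apply/subquotient_classP; rewrite sub0r rpredN.
by apply/bar_coboundaryP; exists x.
Qed.

Lemma bar_cohomology_int (y0 : B (free_group i.+1)) :
  cobar y0 = 0 ->
  (forall y : B (free_group i.+1), cobar y = 0 ->
     exists c x, y = y0 *~ c + cobar x) ->
  (forall c x, y0 *~ c = cobar x -> c = 0) ->
  group_iso (cohomology bar_resolution B i) int.
Proof.
move=> y00 gen0 free0.
have s0P : yoneda y0 \in cocycles bar_resolution B i.
  by apply/bar_cocycleP; rewrite yonedaE.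
pose s0 : subgroup (cocycles bar_resolution B i) :=
  exist (fun s => s \in cocycles bar_resolution B i) (yoneda y0) s0P.
pose q (c : int) : cohomology bar_resolution B i := subquotient_class _ (s0 *~ c).
have qB : zmod_morphism q.
  by move=> c d; rewrite /q mulrzBr subquotient_classB.
have univE (c : int) : val (s0 *~ c) _ (univ i.+1) = y0 *~ c.
  pose ev (s : nat_trans (bar i.+1) B) := s _ (univ i.+1).
  have evB : zmod_morphism ev by [].
  pose evA : {additive nat_trans (bar i.+1) B -> B (free_group i.+1)} :=
    HB.pack ev (GRing.isZmodMorphism.Build _ _ ev evB).
  by rewrite -[LHS]/(evA (val (s0 *~ c))) !raddfMz /= /ev yonedaE.
have q_inj c : q c = 0 -> c = 0.
  have <- : q 0 = 0 by have := qB 0 0; rewrite !subrr.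
  move=> /subquotient_classP; rewrite mulr0z subr0 => /bar_coboundaryP[x].
  by rewrite univE; exact: free0.
have q_surj p : exists c, q c = p.
  have [s <-] := subquotient_class_surj p.
  have [c [x sx]] := gen0 _ ((bar_cocycleP _).1 (valP s)).
  exists c; apply/subquotient_classP; rewrite -opprB rpredN.
  apply/bar_coboundaryP; exists x.
  rewrite -[LHS]/(val s _ (univ i.+1) - val (s0 *~ c) _ (univ i.+1)) univE sx.
  by rewrite addrC addKr.
pose g p := projT1 (cid (q_surj p)).
have gK : cancel g q by move=> p; exact: (projT2 (cid (q_surj p))).
have qK : cancel q g.
  by move=> c; apply/eqP; rewrite -subr_eq0; apply/eqP/q_inj; rewrite qB gK subrr.
have gB : zmod_morphism g by move=> p p'; apply: (can_inj qK); rewrite qB !gK.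
pose gA : {additive cohomology bar_resolution B i -> int} :=
  HB.pack g (GRing.isZmodMorphism.Build _ _ g gB).
by exists gA; exists q.
Qed.

End Cohomology.

(** * Cochains on words *)

Section Words.
Implicit Types (i a l k m N : nat) (v w : seq nat) (f g : seq nat -> int).

(** The action on letters of the coface [i] is dual to [unbump i]. *)
Definition delta N f w : int :=
  \sum_(0 <= i < N.+1) (-1) ^+ i * f [seq unbump i l | l <- w].

Lemma deltaB N f g w : delta N (fun u => f u - g u) w = delta N f w - delta N g w.
Proof. by rewrite -sumrB; apply: eq_bigr => i _; rewrite mulrBr. Qed.

(** The reduced cochains on the [m]-fold smash power of the simplicial circle,
    in degree [N - 1]. In degree [k] the circle has [k] simplices besides the
    base point; the letters 0 and [k + 1] stand for the base point. Level 0 is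
    the zero group, which makes room for the coboundaries in degree 0. *)
Definition cochain m N f : Prop :=
  forall w, size w = m -> f w != 0 -> (0 < N)%N && all (fun l => 0 < l < N)%N w.

(** The simplicial identities: [bump i.+1] is dual to the codegeneracy [i]. *)
Lemma map_unbump_bump a i v : map (unbump a) (map (bump i.+1) v) =
  if (a < i)%N then map (bump i) (map (unbump a) v)
  else if (a <= i.+1)%N then v else map (bump i.+1) (map (unbump a.-1) v).
Proof.
rewrite -!map_comp; case: ltnP => ai; last case: leqP => ai'.
- by apply: eq_map => l; rewrite /= /bump /unbump; lia.
- by rewrite map_id_in // => l _; rewrite /= /bump /unbump; lia.
- by apply: eq_map => l; rewrite /= /bump /unbump; lia.
Qed.

Section Homotopy.
Variables (m k : nat) (f : seq nat -> int).
Hypothesis f_out : forall l v, size v = m -> (k < l)%N -> f (l :: v) = 0.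

(** The contraction of the larger complex in which the first letter may also
    be 0: there the first circle is replaced by an interval with one of its
    ends as base point. *)
Definition contract k f w : int :=
  if w is l :: v then
    \sum_(l <= i < k) (-1) ^+ i * f (i.+1 :: [seq bump i.+1 j | j <- v])
  else 0.

Let F v i a : int :=
  (-1) ^+ i * ((-1) ^+ a * f (i.+1 :: map (bump i.+1) (map (unbump a) v))).

Lemma contract_delta_term i v : (i <= k)%N ->
  (-1) ^+ i * delta k.+1 f (i.+1 :: [seq bump i.+1 j | j <- v]) =
    - (\sum_(0 <= a < i) F v i.-1 a) - (f (i.+1 :: v) - f (i :: v))
    - \sum_(i.+1 <= a < k.+1) F v i a.
Proof.
move=> ik; have ik2 : (i.+1 <= k.+2)%N by lia.
rewrite /delta (big_cat_nat _ ik2) //= big_nat_recr //=.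
rewrite (big_ltn (m := i.+1)) // big_add1 /=.
have unbumpS a : unbump a i.+1 = if (a <= i)%N then i else i.+1.
  by rewrite /unbump ltnS; case: leqP => _; rewrite ?subn1 ?subn0.
rewrite !unbumpS leqnn ltnn !map_unbump_bump ltnn leqnSn leqnn ltnNge leqnSn /=.
have sign2 : (-1) ^+ i * (-1) ^+ i = 1 :> int.
  by rewrite -exprD addnn -mul2n exprM sqrrN expr1n.
rewrite !mulrDr mulrA sign2 mul1r exprS mulN1r mulNr mulrN mulrA sign2 mul1r.
set A := (-1) ^+ i * \sum_(0 <= a < i) _.
set C := (-1) ^+ i * \sum_(_ <= a < _) _.
have -> : A = - \sum_(0 <= a < i) F v i.-1 a.
  rewrite /A mulr_sumr -sumrN; apply: eq_big_nat => a /andP[_ ai].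
  rewrite unbumpS map_unbump_bump ai ltnW // /F.
  by case: i ai {ik ik2 A C unbumpS sign2} => // i _; rewrite exprS mulN1r mulNr.
have -> : C = - \sum_(i.+1 <= a < k.+1) F v i a.
  rewrite /C mulr_sumr -sumrN; apply: eq_big_nat => a /andP[ia _].
  have [a1 a2 a3] : [/\ (a < i) = false, (a.+1 < i) = false &
      (a.+1 <= i.+1) = false]%N by split; lia.
  by rewrite unbumpS map_unbump_bump a1 a2 a3 /F exprS mulN1r mulNr mulrN.
by rewrite opprB !addrA.
Qed.

(** Both sides of the homotopy identity are sums of the same terms [F v i a],
    over complementary ranges. *)
Lemma contract_homotopy l v : size v = m -> (l <= k)%N ->
  contract k.+1 (delta k.+1 f) (l :: v) + delta k (contract k f) (l :: v) =
    f (l :: v).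
Proof.
move=> vm lk; rewrite {1}/contract.
pose S1 i : int := \sum_(0 <= a < i) F v i.-1 a.
pose S2 i : int := \sum_(i.+1 <= a < k.+1) F v i a.
pose D i : int := f (i.+1 :: v) - f (i :: v).
rewrite (eq_big_nat _ _ (F2 := fun i => - S1 i - D i - S2 i)); last first.
  by move=> i /andP[_ ik]; rewrite contract_delta_term.
have telescope : \sum_(l <= i < k.+1) D i = - f (l :: v).
  have lk1 : (l <= k.+1)%N by exact: leqW.
  apply: etrans (telescope_sumr (fun i => f (i :: v)) lk1) _.
  by rewrite (f_out vm) ?sub0r.
have sumS1 : \sum_(l <= i < k.+1) S1 i = \sum_(0 <= i < k)
    \sum_(0 <= a < k.+1 | (l <= i.+1)%N && (a <= i)%N) F v i a.
  have S10 : S1 0%N = 0 by rewrite /S1 big_geq.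
  rewrite (big_nat_widenl _ 0) // big_mkcond big_nat_recl // S10 if_same.
  apply: etrans (add0r _) _; apply: eq_big_nat => i /andP[_ ik].
  case: (leqP l i.+1) => _; last exact/esym/big_pred0.
  by rewrite /S1 (big_nat_widen _ _ k.+1) //=; lia.
have sumS2 : \sum_(l <= i < k.+1) S2 i = \sum_(0 <= i < k)
    \sum_(0 <= a < k.+1 | (l <= i)%N && (i < a)%N) F v i a.
  rewrite big_nat_recr // /S2 (big_geq (leqnn _)).
  apply: etrans (addr0 _) _; rewrite (big_nat_widenl _ 0) // big_mkcond.
  apply: eq_big_nat => i /andP[_ ik].
  case: (leqP l i) => _; last exact/esym/big_pred0.
  by rewrite (big_nat_widenl _ 0).
have deltaE : delta k (contract k f) (l :: v) = \sum_(0 <= i < k)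
    \sum_(0 <= a < k.+1 | (unbump a l <= i)%N) F v i a.
  rewrite (exchange_big_dep_nat xpredT) //=; apply: eq_bigr => a _.
  by rewrite mulr_sumr (big_nat_widenl _ 0) //; apply: eq_bigr => i _; rewrite mulrCA.
have cover : delta k (contract k f) (l :: v) =
    \sum_(l <= i < k.+1) S1 i + \sum_(l <= i < k.+1) S2 i.
  rewrite sumS1 sumS2 deltaE -big_split; apply: eq_bigr => i _ /=.
  rewrite [in LHS]big_mkcond [X in X + _]big_mkcond [X in _ + X]big_mkcond.
  rewrite -big_split; apply: eq_bigr => a _ /=.
  rewrite (_ : (unbump a l <= i) =
    ((l <= i.+1) && (a <= i)) || ((l <= i) && (i < a)))%N; last first.
    by rewrite /unbump; lia.
  case: (leqP a i) => _; rewrite ?andbT ?andbF ?orbF ?orFb ?addr0 ?add0r //.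
rewrite cover sumrB sumrB telescope opprK sumrN.
have cancel (x y z : int) : - x + z - y + (x + y) = z by lia.
exact: cancel.
Qed.

End Homotopy.

Lemma contract_support m k f l v :
  (forall i u, size u = m -> f (i.+1 :: u) != 0 ->
     all (fun j => 0 < j < k.+1)%N u) ->
  size v = m -> contract k f (l :: v) != 0 ->
  (l < k)%N && all (fun j => 0 < j < k)%N v.
Proof.
move=> f_supp vm; apply: contraNT => vk; rewrite /contract.
rewrite big_nat big1 // => i /andP[li ik].
have [->|] := eqVneq (f (i.+1 :: map (bump i.+1) v)) 0; first by rewrite mulr0.
move=> /f_supp; rewrite size_map all_map => /(_ vm) all_v.
case/negP: vk; rewrite (leq_ltn_trans li ik) /=; apply: sub_all all_v => j /=.
by rewrite /bump; lia.
Qed.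

(** Needed for [t = 0], the words in the interval but not in the circle, and
    for [t = 1], the words that their coboundaries involve. *)
Definition first_letter t f w : int :=
  if w is l :: v then if l == t then f v else 0 else 0.

Lemma delta_first_letter0 N f l v : (0 < l)%N ->
  delta N (first_letter 0 f) (l :: v) =
    if l == 1 then f (map (unbump 0) v) else 0.
Proof.
move=> l0; rewrite /delta big_nat_recl // big_nat big1 ?addr0.
  rewrite expr0 mul1r /= /unbump l0 subn1.
  by case: l l0 => [|[|l]].
move=> i _; rewrite /= (_ : unbump _ _ == 0%N = false) ?mulr0 //.
by rewrite /unbump; lia.
Qed.

Lemma delta_first_letter1 N f l v :
  delta N.+1 (first_letter 1 (fun u => f (map (unbump 0) u))) (l :: v) =
    if l == 1 then - delta N f (map (unbump 0) v) else 0.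
Proof.
have [->|l1] := eqVneq l 1%N.
  rewrite /delta big_nat_recl // mulr0 add0r -sumrN.
  apply: eq_big_nat => i _ /=; rewrite exprS mulN1r mulNr -!map_comp.
  congr (- (_ * f _)); apply: eq_map => j; rewrite /= /unbump; lia.
rewrite /delta big_nat_recl // big_nat_recl // big_nat big1 ?addr0; last first.
  move=> i _; rewrite /= (_ : unbump _ _ == 1%N = false) ?mulr0 //.
  by rewrite /unbump; lia.
rewrite /= !mul1r expr1 mulN1r -!map_comp.
have [->|l2] := eqVneq l 2%N.
  apply/eqP; rewrite subr_eq0 /=; apply/eqP; congr f; apply: eq_map => j.
  by rewrite /= /unbump; lia.
have u0 : (unbump 0 l == 1%N) = false by rewrite /unbump; lia.
have u1 : (unbump 1 l == 1%N) = false by rewrite /unbump; lia.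
by rewrite u0 u1 subr0.
Qed.

Lemma signed_sum n (x : int) :
  \sum_(0 <= i < n) (-1) ^+ i * x = if odd n then x else 0.
Proof.
elim: n => [|n IHn]; first by rewrite big_geq.
rewrite big_nat_recr //= IHn -signr_odd; case: odd => /=.
  by rewrite expr1 mulN1r subrr.
by rewrite expr0 mul1r add0r.
Qed.

Lemma delta_nil N f : delta N f [::] = if odd N then 0 else f [::].
Proof. by rewrite [LHS](signed_sum N.+1 (f [::])) /=; case: odd. Qed.

Definition top_word m c w : int := if w == iota 1 m then c else 0.

Lemma top_wordS m c l v : (0 < l)%N ->
  top_word m.+1 c (l :: v) =
    if l == 1 then top_word m c (map (unbump 0) v) else 0.
Proof.
move=> l0; rewrite /top_word /= eqseq_cons; case: eqP => //= _.
rewrite (iotaDl 1 1 m) (_ : (v == _) = (map (unbump 0) v == iota 1 m)) //.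
apply/eqP/eqP => [->|E].
  by rewrite -map_comp map_id_in // => j _; rewrite /= /unbump; lia.
rewrite -E -map_comp map_id_in // => j jv /=.
have : unbump 0 j \in iota 1 m by rewrite -E map_f.
by rewrite mem_iota /unbump; lia.
Qed.

(** By the homotopy, a cocycle [f] is the coboundary of [contract f]. The words
    with first letter 0 prevent this from being a coboundary of cochains on the
    circle; there [contract f] is a cocycle [y] on the words of length [m - 1],
    one level below, to which the induction hypothesis applies. *)
Theorem cocycle_words m N f : cochain m N.+1 f ->
  (forall w, size w = m -> delta N.+1 f w = 0) ->
  exists c g, cochain m N g /\ forall w, size w = m ->
    f w = delta N g w + (if N == m then top_word m c w else 0).
Proof.
elim: m N f => [|m IHm] N f f_cochain f_cocycle.
  have [N0|N0] := posnP N.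
    exists (f [::]), (fun=> 0); split=> [w _|w /size0nil->].
      by rewrite eqxx.
    by rewrite N0 /delta big_nat1 mulr0 add0r.
  (* In positive degree the differential of the constants is alternately 0 and
     the identity. *)
  exists 0, f; split=> [w /size0nil-> _ | w /size0nil->]; first by rewrite N0.
  rewrite addr0 delta_nil; case: ifP => // oddN.
  by have := f_cocycle [::] erefl; rewrite delta_nil /= oddN.
have f0 v : size v = m -> f (0%N :: v) = 0.
  move=> vm; apply: contraTeq isT => /f_cochain; rewrite /= vm.
  by move=> /(_ erefl).
have f_out l v : size v = m -> (N < l)%N -> f (l :: v) = 0.
  move=> vm Nl; apply: contraTeq isT => /f_cochain; rewrite /= vm.
  by move=> /(_ erefl) /= /andP[lN _]; lia.
have f_contract l v : size v = m -> (l <= N)%N ->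
    f (l :: v) = delta N (contract N f) (l :: v).
  move=> vm lN; rewrite -[LHS](contract_homotopy f_out) //.
  rewrite [contract _ _ _]big1 ?add0r //.
  by move=> i _; rewrite f_cocycle ?mulr0 //= size_map vm.
have f_supp i u : size u = m -> f (i.+1 :: u) != 0 ->
    all (fun j => 0 < j < N.+1)%N u.
  move=> um /f_cochain; rewrite /= um => /(_ erefl).
  by case/andP.
case: N => [|p] in f f_cochain f_cocycle f0 f_out f_contract f_supp *.
  exists 0, (fun=> 0); split=> [w _|[|[|l] v] // [vm]]; first by rewrite eqxx.
    by rewrite f0 // /delta big_nat1 mulr0 addr0.
  by rewrite f_out // /delta big_nat1 mulr0 addr0.
pose y v := contract p.+1 f (0%N :: v).
have [||c [g [g_cochain yE]]] := IHm p y.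
- by move=> v vm /(contract_support f_supp vm).
- by move=> v vm; have := f_contract 0%N v vm isT; rewrite f0.
pose g1 w := if w is 0%N :: _ then 0 else contract p.+1 f w.
pose g2 := first_letter 1 (fun v => g (map (unbump 0) v)).
have g12_cochain : cochain m.+1 p.+1 (fun w => g1 w - g2 w).
  move=> [|l v] // [vm] gN0.
  have [/eqP g20|g2N0] := boolP (g2 (l :: v) == 0).
    move: gN0; rewrite g20 subr0; case: l {g20} => [|l]; first by rewrite eqxx.
    by move=> /(contract_support f_supp vm) /= ->.
  move: g2N0; rewrite /g2 /=; case: (eqVneq l 1%N) => [->|_]; last by rewrite eqxx.
  move=> /g_cochain; rewrite size_map => /(_ vm) /andP[p0]; rewrite all_map /=.
  rewrite ltnS p0 /=; apply: sub_all => j /=.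
  by rewrite /unbump; lia.
exists c, (fun w => g1 w - g2 w); split=> // -[|[|l] v] // [vm].
  rewrite f0 // deltaB /g2 delta_first_letter1 /= subr0.
  rewrite [delta _ _ _]big1 ?add0r; last by move=> i _; rewrite mulr0.
  by rewrite /top_word /=; case: ifP.
have [lp|lp] := leqP l p; last first.
  have l1 : (l.+1 == 1%N) = false by lia.
  rewrite f_out // /top_word /= eqseq_cons l1 /=.
  rewrite if_same addr0 /delta big1 // => i _; apply/eqP; rewrite mulf_eq0.
  apply/orP; right; apply: contraTT isT => /g12_cochain.
  by rewrite /= size_map vm => /(_ erefl) /andP[]; rewrite /unbump; lia.
have -> : f (l.+1 :: v) = delta p.+1 g1 (l.+1 :: v) +
    delta p.+1 (first_letter 0 y) (l.+1 :: v).
  rewrite f_contract // -big_split; apply: eq_bigr => i _ /=.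
  by rewrite -mulrDr; congr (_ * _); case: (unbump i _) => [|j] /=;
    rewrite ?add0r ?addr0.
rewrite deltaB delta_first_letter0 // /g2 delta_first_letter1 eqSS.
rewrite top_wordS // -addrA; congr (_ + _).
case: (l.+1 == 1%N); last by rewrite oppr0 add0r if_same.
by rewrite opprK yE // size_map.
Qed.

(** If the coboundary of [g] is [c] times the indicator of the word [1 2 ... m],
    then [c] times the indicator of [0 1 ... m - 1], minus [g], is a cocycle for
    the interval. The coboundary of its contraction is [c] times the indicator
    of [1 2 ... m - 1]. *)
Theorem top_word_not_coboundary m c g : cochain m m g ->
  (forall w, size w = m -> delta m g w = top_word m c w) -> c = 0.
Proof.
elim: m g => [|m IHm] g g_cochain gE.
  have := gE [::] erefl; rewrite /top_word eqxx delta_nil /= => <-.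
  by apply: contraTeq isT => /g_cochain; rewrite /= => /(_ erefl).
have g0 v : size v = m -> g (0%N :: v) = 0.
  move=> vm; apply: contraTeq isT => /g_cochain; rewrite /= vm.
  by move=> /(_ erefl).
pose f w := first_letter 0 (top_word m c) w - g w.
have f_out l v : size v = m -> (m < l)%N -> f (l :: v) = 0.
  case: l => // l vm ml; rewrite /f /= sub0r; apply/eqP; rewrite oppr_eq0.
  apply: contraTT isT => /g_cochain; rewrite /= vm.
  by move=> /(_ erefl) /andP[lm _]; lia.
have f_supp i u : size u = m -> f (i.+1 :: u) != 0 ->
    all (fun j => 0 < j < m.+1)%N u.
  move=> um; rewrite /f /= sub0r oppr_eq0 => /g_cochain; rewrite /= um.
  by move=> /(_ erefl) /andP[].
apply: (IHm (fun v => contract m f (0%N :: v))) => v vm.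
  by move=> /(contract_support f_supp vm).
have := contract_homotopy f_out vm (leq0n m).
rewrite [contract _ _ _]big1 ?add0r; last first.
  move=> i _; rewrite /f deltaB delta_first_letter0 // gE ?top_wordS //=.
    by rewrite subrr mulr0.
  by rewrite size_map vm.
by rewrite {2}/f /= g0 // subr0.
Qed.
End Words.

(** * Powers of the augmentation ideal of a free group *)

Section Powers.
Variables (G : groupType) (r : nat) (b : 'I_r -> G).
Hypothesis bP : free_basis b.
Implicit Types (u v : group_ring G) (j l m : nat) (w : seq nat).

Notation I_ m := (ideal_power (augmentation_ideal G) m).
Notation x j := (aug_gen b j).
Notation fox := (fox bP).

Lemma powerB m u v : u \in I_ m -> v \in I_ m -> u - v \in I_ m.
Proof. by move=> Iu Iv; exact: rpredB. Qed.

Lemma power_mull m u v : v \in I_ m -> u * v \in I_ m.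
Proof.
case: m => // m /asboolP; elim=> {v} [_ [y [z [Iy Iz ->]]]||y z _ Iy _ Iz].
- apply/asboolP/generated_in; exists (u * y), z; rewrite mulrA; split=> //.
  by apply/augmentation_idealP; rewrite augmentationM (eqP Iy) mulr0.
- by rewrite mulr0 rpred0.
- by rewrite mulrBr; exact (powerB Iy Iz).
Qed.

(** As the augmentation ideal is free on the elements [x j], its power [m + 1]
    is the direct sum of the subgroups [x j * I_ m]. *)
Lemma powerS m u :
  u \in I_ m.+1 <-> augmentation u = 0 /\ forall j, fox j u \in I_ m.
Proof.
split=> [/asboolP|[u0 Iu]].
  elim=> {u} [_ [y [z [Iy Iz ->]]]||y z _ [y0 Iy] _ [z0 Iz]].
  - rewrite augmentationM (eqP Iy) mul0r; split=> // j.
    by rewrite foxM (eqP Iy) mulr0z addr0 power_mull.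
  - split=> [|j]; first exact: raddf0.
    by rewrite (raddf0 (fox j)); exact (rpred0 (I_ m)).
  - split=> [|j]; first by rewrite (raddfB (@augmentation G)) /= y0 z0 subrr.
    by rewrite (raddfB (fox j)); exact (powerB (Iy j) (Iz j)).
rewrite (foxE bP u) u0 mulr0z add0r; apply: rpred_sum => j _.
apply/asboolP/generated_in; exists (x j), (fox j u); split=> //.
exact/augmentation_idealP/augmentation_gen.
Qed.

Lemma power1 u : u \in I_ 1 <-> augmentation u = 0.
Proof. by rewrite powerS; split=> [[]|]. Qed.

Lemma power_gen m j u : u \in I_ m -> x j * u \in I_ m.+1.
Proof.
move=> Iu; apply/asboolP/generated_in; exists (x j), u; split=> //.
exact/augmentation_idealP/augmentation_gen.
Qed.

(** The coefficient of the word [w] in the Magnus expansion, which sends the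
    [j]-th basis element to [1 + x j]. *)
Fixpoint coef w u : int :=
  if w is j :: w' then coef w' (fox j u) else augmentation u.

Lemma coef_is_zmod_morphism w : zmod_morphism (coef w).
Proof. by elim: w => [|j w IHw] u v /=; rewrite raddfB ?IHw. Qed.
HB.instance Definition _ w :=
  GRing.isZmodMorphism.Build _ _ (coef w) (coef_is_zmod_morphism w).

Lemma coef_out w u : ~~ all (fun j => 0 < j < r.+1)%N w -> coef w u = 0.
Proof.
elim: w u => //= j w IHw u; rewrite negb_and => /orP[jr|]; last exact: IHw.
by rewrite fox_out // raddf0.
Qed.

Lemma powerP m u : u \in I_ m <-> forall w, (size w < m)%N -> coef w u = 0.
Proof.
elim: m u => [|m IHm] u; first by split.
rewrite powerS; split=> [[u0 Iu] [|j w] //|u0].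
  by move=> wm; exact: ((IHm _).1 (Iu j) w wm).
split=> [|j]; first exact: (u0 [::]).
by apply/IHm => w wm; exact: (u0 (j :: w)).
Qed.

Lemma power_le m n u : (m <= n)%N -> u \in I_ n -> u \in I_ m.
Proof.
move=> mn /powerP u0; apply/powerP => w wm; apply: u0.
exact: leq_trans wm mn.
Qed.

Lemma power_next m u : u \in I_ m ->
  (forall w, size w = m -> coef w u = 0) -> u \in I_ m.+1.
Proof.
move=> /powerP u0 um; apply/powerP => w; rewrite ltnS leq_eqVlt.
by case/orP=> [/eqP|]; [exact: um|exact: u0].
Qed.

Lemma coef_mul w u v : v \in I_ (size w) ->
  coef w (u * v) = augmentation u * coef w v.
Proof.
elim: w u v => [|j w IHw] u v Iv /=; first exact: augmentationM.
have [_ /(_ j) Ijv] := (powerS _ _).1 Iv.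
have uv0 : coef w (fox j u * v) = 0.
  by apply: ((powerP _ _).1 (power_mull (fox j u) Iv)); exact: ltnSn.
rewrite foxM raddfD raddfMz /= uv0 add0r.
by rewrite mulrzz mulrC.
Qed.

(** The Fox derivatives of the sum are its right factors, so the coefficients
    of [realize m f] in degree [m] are the values of [f]. *)
Fixpoint realize m (f : seq nat -> int) : group_ring G :=
  if m is n.+1 then
    \sum_(1 <= j < r.+1) x j * realize n (fun w => f (j :: w))
  else (f [::])%:~R.

Lemma realize_power m f : realize m f \in I_ m.
Proof.
by elim: m f => // m IHm f; apply: rpred_sum => j _; exact: power_gen.
Qed.

Lemma coef_realize w f : all (fun j => 0 < j < r.+1)%N w ->
  coef w (realize (size w) f) = f w.
Proof.
elim: w f => [|j w IHw] f /=; last first.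
  by move=> /andP[jr wr]; rewrite fox_sum //; exact: (IHw (fun s => f (j :: s)) wr).
by rewrite raddfMz /= augmentation1 intz.
Qed.

Lemma coef_prod_gen a m w : (0 < a)%N -> (a + m <= r.+1)%N -> size w = m ->
  coef w (\prod_(a <= j < a + m) x j) = (w == iota a m).
Proof.
elim: m a w => [|m IHm] a [|l w] // a0 ar wm.
  by rewrite addn0 big_geq //= augmentation1.
rewrite big_ltn ?addnS ?ltnS ?leq_addr //= fox_genM; last by lia.
rewrite eqseq_cons eq_sym; case: (eqVneq l a) => _; last by rewrite raddf0.
by rewrite -addSn IHm //; [rewrite addSnnS|case: wm].
Qed.

Lemma prod_gen_power a m : \prod_(a <= j < a + m) x j \in I_ m.
Proof.
elim: m a => // m IHm a.
by rewrite big_ltn ?addnS ?ltnS ?leq_addr // -addSn power_gen.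
Qed.

End Powers.

(** * Cochains with values in the group rings *)

Lemma group_ring_map1 (G H : groupType) (f : {multiplicative G -> H}) :
  group_ring_map f 1 = 1.
Proof. by rewrite -[LHS]/(group_ring_map f (gr_of 1%g)) group_ring_map_of mult_id1. Qed.

Lemma group_ring_map_id (G : fgFreeGroupType) (u : group_ring G) :
  group_ring_map (idfun : {multiplicative G -> G}) u = u.
Proof.
by apply: (malg_ext (f := group_ring_map _) (g := idfun)) => g;
  exact: group_ring_map_of.
Qed.

Lemma group_ring_map_comp (G H K : fgFreeGroupType)
    (g : {multiplicative H -> K}) (f : {multiplicative G -> H})
    (u : group_ring G) :
  group_ring_map (g \o f : {multiplicative G -> K}) u =
  group_ring_map g (group_ring_map f u).
Proof.
apply: (malg_ext (f := group_ring_map _)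
                 (g := group_ring_map g \o group_ring_map f)) => k.
rewrite -[RHS]/(group_ring_map g (group_ring_map f (gr_of k))).
by rewrite !group_ring_map_of; exact: group_ring_map_of.
Qed.

Lemma group_ring_map_sub1 (G H : groupType) (f : {multiplicative G -> H}) g :
  group_ring_map f (gr_of g - 1) = gr_of (f g) - 1.
Proof.
rewrite -(group_ring_map_of f) -(group_ring_map1 f).
exact: (raddfB (group_ring_map f) (gr_of g) 1).
Qed.

Lemma fox_sub1 (G : groupType) (r : nat) (b : 'I_r -> G) (bP : free_basis b) l g :
  fox bP l (gr_of g - 1) = fox bP l (gr_of g).
Proof.
rewrite -[RHS]subr0 -(fox1 bP l).
exact: (raddfB (fox bP l) (gr_of g) 1).
Qed.

Lemma augmentation_fox_ofM (G : groupType) (r : nat) (b : 'I_r -> G)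
    (bP : free_basis b) l (g h : G) :
  augmentation (fox bP l (gr_of (g * h)%g)) =
  augmentation (fox bP l (gr_of g)) + augmentation (fox bP l (gr_of h)).
Proof.
rewrite fox_ofM; transitivity (augmentation (fox bP l (gr_of g) * gr_of h) +
    augmentation (fox bP l (gr_of h))); first exact (augmentationD _ _).
by rewrite augmentationM augmentation_of mulr1.
Qed.

Definition group_ring_functor : functor :=
  @Functor (fun G => group_ring G)
    (fun G H f => group_ring_map f : {additive group_ring G -> group_ring H})
    group_ring_map_id group_ring_map_comp.

Notation Z_ k := (group_ring (free_group k)).
Notation I_ k m := (ideal_power (augmentation_ideal (free_group k)) m).
Notation x_ k j := (aug_gen (@letter k) j).
Notation coef_ k := (coef (@free_group_basis k)).

Definition dR k (u : Z_ k) : Z_ k.+1 := @cobar group_ring_functor k u.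

Lemma dRB k (u v : Z_ k) : dR (u - v) = dR u - dR v.
Proof. exact (@cobar_is_zmod_morphism group_ring_functor k u v). Qed.
HB.instance Definition _ k :=
  GRing.isZmodMorphism.Build (Z_ k) (Z_ k.+1) (@dR k) (@dRB k).

Section Coface.
Variables (k i : nat).
Hypothesis ik : (i <= k.+1)%N.
Notation map := (group_ring_map (coface k i)).

(** The linear part of a coface. For [j = i] the quadratic term of
    [x i + x i.+1 + x i * x i.+1] has no augmented Fox derivative. *)
Lemma fox_coface l j : (0 < j <= k)%N -> (0 < l <= k.+1)%N ->
  augmentation (fox (@free_group_basis k.+1) l (map (x_ k j))) =
    (unbump i l == j).
Proof.
move=> jk lk; rewrite group_ring_map_sub1 fox_sub1 /coface free_liftE // /face.
have genE a : (0 < a <= k.+1)%N ->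
    augmentation (fox (@free_group_basis k.+1) l (gr_of (gen k.+1 a))) = (a == l).
  by move=> ak; rewrite fox_basis //; case: eqP; rewrite ?augmentation1 ?raddf0.
have jk1 : (0 < j <= k.+1)%N by lia.
have jk2 : (0 < j.+1 <= k.+1)%N by lia.
case: ltnP => [ji|ij]; last case: eqP => [ji|ji].
- rewrite genE // (_ : (j == l) = (unbump i l == j)) //.
  by apply/eqP/eqP; rewrite /unbump; lia.
- apply: etrans (augmentation_fox_ofM _ _ _ _) _.
  apply: etrans (f_equal2 +%R (genE _ jk1) (genE _ jk2)) _.
  rewrite ji; have [->|li] := eqVneq i l.
    by rewrite /unbump ltnn subn0 eqxx gtn_eqF.
  rewrite add0r (_ : (i.+1 == l) = (unbump i l == i)) //.
  by apply/eqP/eqP; rewrite /unbump; lia.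
- rewrite genE // (_ : (j.+1 == l) = (unbump i l == j)) //.
  by apply/eqP/eqP; rewrite /unbump; lia.
Qed.
End Coface.

Section CofaceCoefficients.
Variables (k i : nat).
Hypothesis ik : (i <= k.+1)%N.
Notation map := (group_ring_map (coface k i)).
Notation fox_ k := (fox (@free_group_basis k)).

Lemma coef_coface_term l w j (u : Z_ k) : (0 < j <= k)%N ->
  (0 < l <= k.+1)%N -> u \in I_ k (size w) ->
  coef_ k.+1 (l :: w) (map (x_ k j * u)) =
    if unbump i l == j then coef_ k.+1 w (map u) else 0.
Proof.
move=> jk lk Iu; rewrite group_ring_mapM.
rewrite -[LHS]/(coef_ k.+1 w (fox_ k.+1 l (map (x_ k j) * map u))).
rewrite foxM augmentation_map augmentation_gen mulr0z addr0.
rewrite coef_mul; last exact: group_ring_map_power.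
by rewrite fox_coface //; case: eqP => _; rewrite ?mul1r ?mul0r.
Qed.

Lemma coef_coface w (z : Z_ k) : z \in I_ k (size w) ->
  coef_ k.+1 w (map z) = coef_ k [seq unbump i l | l <- w] z.
Proof.
elim: w z => [|l w IHw] z Iz; first exact: augmentation_map.
have [lk|lk] := boolP (0 < l <= k.+1)%N; last first.
  rewrite !coef_out //= negb_and; apply/orP; left; rewrite ?ltnS //.
  by move: lk; rewrite /unbump; lia.
have [z0 Izj] := (powerS (@free_group_basis k) _ _).1 Iz.
rewrite [z in LHS](foxE (@free_group_basis k)) z0 mulr0z add0r.
have -> : coef_ k.+1 (l :: w)
    (map (\sum_(1 <= j < k.+1) x_ k j * fox_ k j z)) =
  \sum_(1 <= j < k.+1)
    if j == unbump i l then coef_ k [seq unbump i l | l <- w] (fox_ k j z) else 0.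
  rewrite (raddf_sum map) (raddf_sum (coef_ k.+1 (l :: w))).
  apply: eq_big_nat => j jk; rewrite -IHw // eq_sym.
  exact (coef_coface_term jk lk (Izj j)).
rewrite -big_mkcond (big_nat1_eq +%R) ltnS.
by case: ifP => // jk; rewrite /= fox_out ?raddf0 ?jk.
Qed.

End CofaceCoefficients.

(** The filtration by the powers of the augmentation ideal has the cochains on
    words as associated graded complex. *)
Lemma coef_dR k w (z : Z_ k) : z \in I_ k (size w) ->
  coef_ k.+1 w (dR z) = delta k.+1 (fun v => coef_ k v z) w.
Proof.
move=> Iz; rewrite /delta big_mkord /dR /cobar.
rewrite (raddf_sum (coef_ k.+1 w)); apply: eq_bigr => i _.
rewrite raddfMz mulrzz [LHS]mulrC; congr (_ * _).
exact (@coef_coface k i (ltn_ord i) w z Iz).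
Qed.

Section AlternatingProduct.
Variables (R : nzRingType) (x : nat -> R) (n : nat).

(** The image of the generator [j] under the coface [i]. *)
Let merged i j : R :=
  if (j < i)%N then x j
  else if j == i then x j + x j.+1 + x j * x j.+1 else x j.+1.

Let omit i : R := \prod_(1 <= j < n.+1) (if (j < i)%N then x j else x j.+1).
Let full : R := \prod_(1 <= j < n.+2) x j.

Lemma prod_nat_split i (F : nat -> R) : (0 < i <= n)%N ->
  \prod_(1 <= j < n.+1) F j =
    \prod_(1 <= j < i) F j * F i * \prod_(i.+1 <= j < n.+1) F j.
Proof.
case/andP=> i0 ik; rewrite (@big_cat_nat _ _ _ i) //=; last exact: leqW.
by rewrite (big_ltn (m := i)) // mulrA.
Qed.

Lemma merged_prod i : (0 < i <= n)%N ->
  \prod_(1 <= j < n.+1) merged i j = omit i.+1 + omit i + full.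
Proof.
move=> ik; pose lo := \prod_(1 <= j < i) x j.
pose hi := \prod_(i.+1 <= j < n.+1) x j.+1.
have below (F : nat -> R) : (forall j, (j < i)%N -> F j = x j) ->
    \prod_(1 <= j < i) F j = lo.
  by move=> Fx; apply: eq_big_nat => j /andP[_ ji]; exact: Fx.
have above (F : nat -> R) : (forall j, (i < j)%N -> F j = x j.+1) ->
    \prod_(i.+1 <= j < n.+1) F j = hi.
  by move=> Fx; apply: eq_big_nat => j /andP[ij _]; exact: Fx.
rewrite /omit !(prod_nat_split _ ik) !below => [|j ji|j ji|j ji]; first last.
- by rewrite /merged ji.
- by rewrite ltnW.
- by rewrite ji.
rewrite !above => [|j ij|j ij|j ij]; first last.
- by rewrite /merged ltnNge ltnW // gtn_eqF.
- by rewrite ltnS leqNgt ij.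
- by rewrite ltnNge ltnW.
have fullE : full = lo * (x i * x i.+1) * hi.
  have [i0 iN iN1] : [/\ 0 < i, i <= n.+2 & i < n.+2]%N by split; lia.
  have iN2 : (i.+1 < n.+2)%N by lia.
  rewrite /full (big_cat_nat i0 iN) (big_ltn iN1) (big_ltn iN2).
  by rewrite (big_add1 _ _ i.+1) /= !mulrA.
by rewrite /merged ltnn eqxx ltnS leqnn fullE !mulrDr !mulrDl.
Qed.

(** The products omitting one factor telescope; what is left is the alternating
    sum of [n] copies of the full product. *)
Lemma alternating_merged :
  \sum_(i < n.+2) (\prod_(1 <= j < n.+1) merged i j) *~ (-1) ^+ i =
    if odd n then - full else 0.
Proof.
have cancel (a b c d : R) : a - c - (b + a + d) = - b - (c + d).
  rewrite !opprD !addrA [LHS](ACl ((1*4)*3*2*5)%AC) /=.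
  by rewrite subrr sub0r.
have partial k : (k <= n)%N ->
    \sum_(0 <= i < k.+1) (\prod_(1 <= j < n.+1) merged i j) *~ (-1) ^+ i =
      omit k.+1 *~ (-1) ^+ k - full *~ odd k.
  elim: k => [|k IHk] kn.
    rewrite big_nat1 subr0 !mulr1z; apply: eq_big_nat => j /andP[j0 _].
    by rewrite /merged /= ltnNge j0 gtn_eqF.
  rewrite big_nat_recr // IHk 1?ltnW // merged_prod ?kn // exprS mulN1r.
  have -> : full *~ odd k.+1 = full *~ odd k + full *~ (-1) ^+ k.
    by rewrite -mulrzDr -signr_odd /=; case: odd.
  rewrite !mulrNz !mulrzDl; exact: cancel.
rewrite -(big_mkord xpredT (fun i =>
  (\prod_(1 <= j < n.+1) merged i j) *~ (-1) ^+ i)) big_nat_recr // partial //.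
rewrite exprS mulN1r mulrNz /=.
have -> : \prod_(1 <= j < n.+1) merged n.+1 j = omit n.+1.
  by apply: eq_big_nat => j /andP[_ jn]; rewrite /merged jn.
by rewrite addrAC subrr sub0r; case: odd; rewrite ?mulr1z ?mulr0z ?oppr0.
Qed.

End AlternatingProduct.

Definition top k : Z_ k := \prod_(1 <= j < k.+1) x_ k j.

Lemma top_power k : top k \in I_ k k.
Proof. exact: prod_gen_power. Qed.

Lemma coef_top k w : size w = k -> coef_ k w (top k) = top_word k 1 w.
Proof.
move=> wk; rewrite /top -[k.+1 in X in coef _ _ X]add1n coef_prod_gen //.
by rewrite /top_word; case: eqP.
Qed.

Lemma gen_mul (G : groupType) (g h : G) :
  gr_of (g * h)%g - 1 =
    (gr_of g - 1) + (gr_of h - 1) + (gr_of g - 1) * (gr_of h - 1).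
Proof.
have E (R : nzRingType) (a c : R) :
    a * c - 1 = (a - 1) + (c - 1) + (a - 1) * (c - 1).
  by rewrite mulrBl mulrBr mulr1 mul1r addrACA subrr addr0 addrC addrA subrK.
by rewrite gr_ofM; exact: E.
Qed.

Lemma coface_top k i : group_ring_map (coface k i) (top k) =
  \prod_(1 <= j < k.+1) (if (j < i)%N then x_ k.+1 j else if j == i then
    x_ k.+1 j + x_ k.+1 j.+1 + x_ k.+1 j * x_ k.+1 j.+1 else x_ k.+1 j.+1).
Proof.
rewrite /top (big_morph _ (group_ring_mapM (coface k i)) (group_ring_map1 _)).
apply: eq_big_nat => j jk; rewrite group_ring_map_sub1 /coface free_liftE // /face.
case: ifP => // _; case: ifP => // _.
exact: gen_mul.
Qed.

Lemma dR_top k : dR (top k) = if odd k then - top k.+1 else 0.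
Proof.
rewrite -(alternating_merged (fun j => x_ k.+1 j)); apply: eq_bigr => i _.
exact (f_equal (fun u => u *~ _) (coface_top k i)).
Qed.

Lemma dR_dR k (u : Z_ k) : dR (dR u) = 0.
Proof. exact (@cobar_cobar group_ring_functor k u). Qed.

Lemma dR_power k m (u : Z_ k) : u \in I_ k m -> dR u \in I_ k.+1 m.
Proof.
move=> Iu; apply: rpred_sum => i _; apply: rpredMz.
exact: group_ring_map_power.
Qed.

Lemma powerMz k m (u : Z_ k) (c : int) : u \in I_ k m -> u *~ c \in I_ k m.
Proof. by move=> Iu; exact: rpredMz. Qed.

Lemma powerN k m (u : Z_ k) : u \in I_ k m -> - u \in I_ k m.
Proof. by move=> Iu; rewrite rpredN. Qed.

Lemma powerD k m (u v : Z_ k) :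
  u \in I_ k m -> v \in I_ k m -> u + v \in I_ k m.
Proof. by move=> Iu Iv; exact: rpredD. Qed.

Lemma coefB k w (u v : Z_ k) : coef_ k w (u - v) = coef_ k w u - coef_ k w v.
Proof. exact: raddfB. Qed.

Lemma coefMz k w (u : Z_ k) (c : int) : coef_ k w (u *~ c) = coef_ k w u * c.
Proof. by rewrite raddfMz mulrzz. Qed.

Lemma coef_cochain k m (u : Z_ k) : cochain m k.+1 (fun w => coef_ k w u).
Proof.
by move=> w wm; apply: contraNT => wk; rewrite coef_out.
Qed.

(** [cocycle_words] for the leading term of [z], which is a cocycle of the
    associated graded complex. *)
Lemma leading_cocycle k m (z : Z_ k.+1) :
  z \in I_ k.+1 m -> dR z \in I_ k.+2 m.+1 ->
  exists c u, u \in I_ k m /\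
    z - dR u - top k.+1 *~ (if k.+1 == m then c else 0) \in I_ k.+1 m.+1.
Proof.
move=> Iz Idz.
have [w wm|c [g [g_cochain gE]]] := cocycle_words (@coef_cochain k.+1 m z).
  rewrite -wm in Iz Idz *; rewrite -(coef_dR Iz).
  exact: (powerP (@free_group_basis _) _ _).1 Idz _ (ltnSn _).
pose u : Z_ k := realize (@letter k) m g.
have Iu : u \in I_ k m by exact: realize_power.
have coef_u w : size w = m -> coef_ k w u = g w.
  move=> wm; have [wk|wk] := boolP (all (fun j => 0 < j < k.+1)%N w).
    by rewrite /u -wm coef_realize.
  rewrite coef_out //; apply/esym; apply: contraNeq wk => /(g_cochain _ wm).
  by case/andP.
have coef_du w : size w = m -> coef_ k.+1 w (dR u) = delta k.+1 g w.
  move=> wm; have Iu' : u \in I_ k (size w) by rewrite wm.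
  rewrite (coef_dR Iu'); apply: eq_bigr => i _.
  by rewrite coef_u ?size_map.
exists c, u; split=> //.
have Idu : dR u \in I_ k.+1 m by exact: dR_power.
refine (power_next (bP := @free_group_basis k.+1) _ _) => [|w wm].
  refine (powerB (powerB Iz Idu) _); case: eqP => [<-|_].
    exact (powerMz c (top_power k.+1)).
  exact (rpred0 (I_ k.+1 m)).
rewrite !coefB coefMz gE // coef_du // [delta _ _ _ + _]addrC addrK.
case: eqP => [km|_]; last by rewrite mulr0 subrr.
by rewrite coef_top ?wm // /top_word km; case: eqP; rewrite ?mul1r ?mul0r subrr.
Qed.

Lemma top_not_boundary k c (u : Z_ k) : u \in I_ k k.+1 ->
  top k.+1 *~ c - dR u \in I_ k.+1 k.+2 -> c = 0.
Proof.
move=> Iu Itu; apply: (top_word_not_coboundary (@coef_cochain k k.+1 u)) => w wk.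
have Iu' : u \in I_ k (size w) by rewrite wk.
rewrite -(coef_dR Iu') -[LHS]/(coef_ k.+1 w (dR u)).
have := (powerP (@free_group_basis _) _ _).1 Itu w; rewrite wk ltnSn => /(_ isT).
rewrite coefB coefMz coef_top // => /eqP; rewrite subr_eq0 => /eqP <-.
by rewrite /top_word; case: eqP; rewrite ?mul1r ?mul0r.
Qed.

Lemma cobar_corrected k (z : Z_ k.+1) u : dR (z - dR u) = dR z.
Proof. by rewrite dRB dR_dR subr0. Qed.

Lemma dRD k (u v : Z_ k) : dR (u + v) = dR u + dR v.
Proof. exact: raddfD. Qed.

Lemma corrected_twice k (z : Z_ k.+1) u v : z - dR u - dR v = z - dR (u + v).
Proof.
have E (V : zmodType) (a b c : V) : a - b - c = a - (b + c).
  by rewrite opprD addrA.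
by rewrite dRD; exact: E.
Qed.

Lemma dRMz k (u : Z_ k) (c : int) : dR (u *~ c) = dR u *~ c.
Proof. exact: raddfMz. Qed.

Lemma corrected_top k (z : Z_ k.+1) u c : odd k ->
  z - dR (u - top k *~ c) = z - dR u - top k.+1 *~ c.
Proof.
move=> odd_k; rewrite dRB dRMz dR_top odd_k mulNrz.
have E (V : zmodType) (a b d : V) : a - (b - - d) = a - b - d.
  by rewrite opprK opprD addrA.
exact: E.
Qed.

(** For odd [m] the contributions of the orders [m] and [m + 1] cancel: the
    class of [top m] does not survive since its coboundary is [- top m.+1],
    whose class is of infinite order, and this also makes the class of
    [top m.+1] vanish. *)
Lemma odd_step k m (z : Z_ k.+1) : odd m ->
  z \in I_ k.+1 m -> dR z \in I_ k.+2 m.+2 ->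
  exists u, u \in I_ k m /\ z - dR u \in I_ k.+1 m.+2.
Proof.
move=> odd_m Iz Idz.
have Idz' : dR z \in I_ k.+2 m.+1.
  exact (power_le (@free_group_basis _) (leqnSn m.+1) Idz).
have [c [u [Iu Ir]]] := leading_cocycle Iz Idz'.
have {}Ir : z - dR u \in I_ k.+1 m.+1.
  move: Ir; case: eqVneq => [km|_]; last by rewrite mulr0z subr0.
  subst m; set r := z - _ - _ => Ir.
  have dr : dR r = dR z + top k.+2 *~ c.
    by rewrite /r dRB cobar_corrected dRMz dR_top odd_m mulNrz opprK.
  have c0 : c = 0.
    apply: (top_not_boundary Ir); rewrite dr opprD addrC addrNK.
    exact (powerN Idz).
  by move: Ir; rewrite /r c0 mulr0z subr0.
have Idr : dR (z - dR u) \in I_ k.+2 m.+2 by rewrite cobar_corrected.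
have [c' [v [Iv]]] := leading_cocycle Ir Idr.
have {}Iv : v \in I_ k m by exact (power_le (@free_group_basis _) (leqnSn m) Iv).
case: eqVneq => [[km]|_] Iz'; last first.
  exists (u + v); split; first exact (powerD Iu Iv).
  by rewrite mulr0z subr0 corrected_twice in Iz'.
subst m; exists (u + v - top k *~ c'); split.
  exact (powerB (powerD Iu Iv) (powerMz c' (top_power k))).
rewrite (corrected_top z (u + v) c' odd_m) -(corrected_twice z u v).
exact Iz'.
Qed.

(** The orders below [2 n + 1] are removed in pairs, by [odd_step]. *)
Lemma even_cocycle n k (z : Z_ k.+1) :
  z \in I_ k.+1 1 -> dR z \in I_ k.+2 n.*2.+1 ->
  exists u, u \in I_ k 1 /\ z - dR u \in I_ k.+1 n.*2.+1.
Proof.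
elim: n => [|n IHn] in z *; move=> Iz Idz.
  exists 0; split; first exact (rpred0 (I_ k 1)).
  by rewrite (raddf0 (@dR k)) subr0.
have [|u [Iu Izu]] := IHn z Iz.
  by apply: (power_le (@free_group_basis _) _ Idz); rewrite doubleS; lia.
have [|||v [Iv Izv]] := @odd_step k n.*2.+1 (z - dR u).
- by rewrite /= odd_double.
- exact Izu.
- by rewrite cobar_corrected; exact Idz.
exists (u + v); split.
  by apply: (powerD Iu); exact (power_le (@free_group_basis _) (ltn0Sn _) Iv).
by rewrite -corrected_twice; exact Izv.
Qed.

Lemma odd_cocycle n k (z : Z_ k.+1) :
  z \in I_ k.+1 1 -> dR z \in I_ k.+2 n.*2.+2 ->
  exists c u, u \in I_ k 1 /\
    z - dR u - top k.+1 *~ (if k == n.*2 then c else 0) \in I_ k.+1 n.*2.+2.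
Proof.
move=> Iz Idz; have [|u [Iu Izu]] := even_cocycle (n := n) Iz.
  exact (power_le (@free_group_basis _) (leqnSn _) Idz).
have [|c [v [Iv Izv]]] := leading_cocycle Izu.
  by rewrite cobar_corrected.
exists c, (u + v); split.
  by apply: (powerD Iu); exact (power_le (@free_group_basis _) (ltn0Sn _) Iv).
by rewrite -corrected_twice; move: Izv; rewrite eqSS.
Qed.

(** The coboundary of [u] has order [2 n + 1], so that [u] can be corrected to
    this order by [even_cocycle]; then only leading terms matter. *)
Lemma odd_top_free n c (u : Z_ n.*2) : u \in I_ n.*2 1 ->
  top n.*2.+1 *~ c - dR u \in I_ n.*2.+1 n.*2.+2 -> c = 0.
Proof.
case: n u => [|n] u Iu Itu; first exact: top_not_boundary Iu Itu.
have Idu : dR u \in I_ n.*2.+3 n.*2.+3.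
  have Itop := powerMz c (top_power n.*2.+3).
  have := powerB Itop (power_le (@free_group_basis _) (leqnSn _) Itu).
  by rewrite opprB addrC subrK.
have [v [_ Iuv]] := even_cocycle (n := n.+1) Iu Idu.
apply: (top_not_boundary (k := n.*2.+2) (u := u - dR v)); first exact Iuv.
by rewrite cobar_corrected; exact Itu.
Qed.

(** * Cochains with values in the Passi functors *)

Section PassiCochains.
Variable n : nat.

Lemma augmentation_trivial (x : Z_ 0) : augmentation x = 0 -> x = 0.
Proof.
by move=> x0; rewrite [x](foxE (@free_group_basis 0)) x0 big_geq // addr0.
Qed.

Lemma Pa_trivial (y : Pa n (free_group 0)) : y = 0.
Proof.
have [s <-] := subquotient_class_surj y.
have -> : s = 0.
  by apply: val_inj; apply: augmentation_trivial; apply/eqP/(valP s).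
by rewrite -[RHS](subrr (subquotient_class _ 0)) -subquotient_classB subrr.
Qed.

Notation aug k := (subgroup (augmentation_ideal (free_group k))).

Definition passi_class k (s : aug k) : Pa n (free_group k) :=
  subquotient_class _ s.

Lemma passi_class_is_zmod_morphism k : zmod_morphism (@passi_class k).
Proof. by move=> s t; exact: subquotient_classB. Qed.
HB.instance Definition _ k := GRing.isZmodMorphism.Build _ _ (@passi_class k)
  (@passi_class_is_zmod_morphism k).

Lemma passi_classP k (s t : aug k) :
  passi_class s = passi_class t <-> val s - val t \in I_ k n.+1.
Proof. exact: subquotient_classP. Qed.

Definition cobar_aug k (s : aug k) : aug k.+1 :=
  \sum_(i < k.+2) subgroup_map (@group_ring_map_ideal _ _ (coface k i)) s
    *~ (-1) ^+ i.

Lemma val_cobar_aug k (s : aug k) : val (cobar_aug s) = dR (val s).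
Proof.
rewrite /cobar_aug raddf_sum; apply: eq_bigr => i _.
by rewrite raddfMz.
Qed.

Lemma cobar_passi k (s : aug k) : cobar (passi_class s) = passi_class (cobar_aug s).
Proof.
rewrite /cobar_aug (raddf_sum (@passi_class k.+1)); apply: eq_bigr => i _.
rewrite raddfMz; congr (_ *~ _); exact: passi_mapE.
Qed.

Lemma passi_cocycleP k (s : aug k) :
  cobar (passi_class s) = 0 <-> dR (val s) \in I_ k.+1 n.+1.
Proof.
rewrite cobar_passi -(raddf0 (@passi_class k.+1)) passi_classP.
by rewrite val_cobar_aug subr0.
Qed.

Lemma val_power1 k (s : aug k) : val s \in I_ k 1.
Proof. by apply/(power1 (@free_group_basis k))/eqP/(valP s). Qed.

Lemma power1_aug k (u : Z_ k) : u \in I_ k 1 ->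
  u \in augmentation_ideal (free_group k).
Proof. by move=> Iu; apply/eqP/(power1 (@free_group_basis k)). Qed.

Definition aug_elt k (u : Z_ k) (Iu : u \in I_ k 1) : aug k :=
  exist (fun u => u \in augmentation_ideal (free_group k)) u (power1_aug Iu).

Lemma passi_coboundaryP k (s : aug k.+1) :
  (exists y, passi_class s = cobar y) <->
  exists u : Z_ k, u \in I_ k 1 /\ val s - dR u \in I_ k.+1 n.+1.
Proof.
split=> [[y]|[u [Iu su]]].
  have [t <-] := subquotient_class_surj y.
  rewrite -[X in cobar X]/(passi_class t).
  rewrite cobar_passi passi_classP val_cobar_aug => st; exists (val t); split=> //.
  exact: val_power1.
exists (passi_class (aug_elt Iu)).
by rewrite cobar_passi passi_classP val_cobar_aug.
Qed.

End PassiCochains.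


Lemma group_iso_trans (U V W : zmodType) :
  group_iso U V -> group_iso V W -> group_iso U W.
Proof.
move=> [f fK] [g gK]; exists (g \o f : {additive U -> W}).
exact: bij_comp gK fK.
Qed.

Theorem corollary11p14 (n : nat) (n_ge1 : (1 <= n)%N) :
  graded_iso (Ext ab (Pa n))
    (if odd n then suspension n.-1 int else graded_zero).
Proof.
move=> i; apply: group_iso_trans (cohomology_iso _ _ bar_resolution i) _.
have nE := odd_double_half n; case: ifP => [odd_n|even_n]; last first.
  apply: bar_cohomology_trivial; first exact: Pa_trivial.
  move=> y; have [s <-] := subquotient_class_surj y.
  move=> /passi_cocycleP ds; apply/passi_coboundaryP.
  rewrite -nE even_n add0n in ds *.
  exact: even_cocycle (val_power1 s) ds.
move: nE; rewrite odd_n add1n; move: n./2 => m nE; subst n.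
rewrite /suspension /=; case: eqVneq => [->|im].
  have top1 : top m.*2.+1 \in I_ m.*2.+1 1.
    exact (power_le (@free_group_basis _) (ltn0Sn _) (top_power m.*2.+1)).
  pose s0 := aug_elt top1.
  have valMz c : val (s0 *~ c) = top m.*2.+1 *~ c by rewrite raddfMz.
  apply: (bar_cohomology_int (@Pa_trivial _) (y0 := passi_class m.*2.+1 s0)).
  - apply/passi_cocycleP; rewrite /= dR_top /= odd_double /=.
    exact (powerN (top_power m.*2.+2)).
  - move=> y; have [s <-] := subquotient_class_surj y.
    move=> /passi_cocycleP ds; have [c [u [Iu su]]] := odd_cocycle (val_power1 s) ds.
    rewrite eqxx in su.
    have [x sx] : exists x, passi_class m.*2.+1 (s - s0 *~ c) = cobar x.
      apply/passi_coboundaryP; exists u; split=> //.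
      by rewrite raddfB /= valMz (addrAC (val s)).
    exists c, x; rewrite -sx raddfB /= raddfMz /= addrC subrK.
    by [].
  - move=> c x s0x.
    have [u [Iu]] : exists u, u \in I_ m.*2 1 /\
        val (s0 *~ c) - dR u \in I_ m.*2.+1 m.*2.+2.
      apply/passi_coboundaryP; exists x; rewrite -s0x; exact: raddfMz.
    rewrite valMz; exact: odd_top_free Iu.
apply: bar_cohomology_trivial; first exact: Pa_trivial.
move=> y; have [s <-] := subquotient_class_surj y.
move=> /passi_cocycleP ds; apply/passi_coboundaryP.
have [c [u [Iu]]] := odd_cocycle (val_power1 s) ds.
rewrite (negbTE im) mulr0z subr0 => su.
by exists u.
Qed.
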